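(* Let $n\in\mathbb{N}$ and $\alpha,\beta>-1$, and put $\sigma:=\alpha+\beta+1$. For every $i=0,1,\ldots,n$, \[ D^n_i(x;\alpha,\beta)=\sum_{j=0}^{n}c_{ij}(n,\alpha,\beta)\,B^n_j(x), \] where the coefficients $c_{ij}(n,\alpha,\beta)$ ($0\le j\le n$) are given by either of the following two (equal) expressions: \[ c_{ij}(n,\alpha,\beta)=\frac{1}{B(\alpha+1,\beta+1)}\sum_{m=0}^n\frac{(2m/\sigma+1)(\beta+1)_m(\sigma)_m}{m!\,(\alpha+1)_m}\,Q_m(i;\beta,\alpha,n)\,Q_m(j;\beta,\alpha,n), \] \[ c_{ij}(n,\alpha,\beta)=\frac{(-1)^{n}(\sigma+1)_{n}(-\alpha-n)_i}{B(\alpha+1,\beta+1)\,n!\,(\beta+1)_i}\sum_{h=0}^{i}\frac{(-i)_h}{(-\alpha-n)_h}\,Q_{n-h}(n-j;\alpha,\beta+h+1,n). \]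
   Context: For $\alpha,\beta>-1$ define the inner product $\langle f,g\rangle:=\int_0^1(1-x)^{\alpha}x^{\beta}f(x)g(x)\,dx$. The Bernstein polynomials of degree $n$ are $B^n_i(x)=\binom ni x^i(1-x)^{n-i}$, $0\le i\le n$. The dual Bernstein polynomials $D^n_0(x;\alpha,\beta),\ldots,D^n_n(x;\alpha,\beta)$ are the unique polynomials of degree at most $n$ with $\langle D^n_i,B^n_j\rangle=\delta_{ij}$ for $i,j=0,\ldots,n$. Notation: $(c)_k:=\prod_{j=0}^{k-1}(c+j)$ (with $(c)_0=1$); $B(\lambda,\mu)=\Gamma(\lambda)\Gamma(\mu)/\Gamma(\lambda+\mu)$; ${}_rF_s$ denotes the generalized hypergeometric series $\sum_{k\ge0}\frac{(a_1)_k\cdots(a_r)_k}{k!(b_1)_k\cdots(b_s)_k}z^k$. The Hahn polynomials are $Q_m(x;a,b,N):={}_3F_2\!\left(-m,\,m+a+b+1,\,-x;\;a+1,\,-N;\;1\right)$ for $m=0,1,\ldots,N$, $N\in\mathbb{N}$ (a terminating sum, since $(-m)_k=0$ for $k>m$).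
   Formalization: When σ = α+β+1 = 0 (allowed, e.g. α = β = −1/2) the factor 2m/σ is undefined; (2m/σ+1)(σ)_m is read as (2m+σ)(σ+1)_{m−1} for m ≥ 1 and as 1 for m = 0, which is the same whenever σ ≠ 0 and its limit at σ = 0. *)

(* Defs.v *)
From Stdlib Require Export Reals Lra ClassicalEpsilon Factorial Binomial.
Open Scope R_scope.

(* [improper01 f L]: f is Riemann integrable on every [a,b] with 0<a<=b<1 and
   int_a^b f -> L as a -> 0+, b -> 1-.  (Value of RiemannInt does not depend
   on the integrability proof, so quantifying over it is harmless.) *)
Definition improper01 (f : R -> R) (L : R) : Prop :=
  (forall a b, 0 < a -> a <= b -> b < 1 -> inhabited (Riemann_integrable f a b)) /\
  (forall eps, eps > 0 -> exists delta, delta > 0 /\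
     forall a b (pr : Riemann_integrable f a b),
       0 < a < delta -> 1 - delta < b < 1 -> Rabs (RiemannInt pr - L) < eps).

Definition improper0inf (f : R -> R) (L : R) : Prop :=
  (forall a b, 0 < a -> a <= b -> inhabited (Riemann_integrable f a b)) /\
  (forall eps, eps > 0 -> exists delta M, delta > 0 /\
     forall a b (pr : Riemann_integrable f a b),
       0 < a < delta -> M < b -> Rabs (RiemannInt pr - L) < eps).

Definition Gamma (x : R) : R :=
  epsilon (inhabits 0)
    (fun L => improper0inf (fun t => Rpower t (x - 1) * exp (- t)) L).

Definition Beta (l m : R) : R := Gamma l * Gamma m / Gamma (l + m).

Fixpoint poch (c : R) (k : nat) : R :=
  match k with
  | O => 1
  | S k' => poch c k' * (c + INR k')
  end.

Definition Bern (n i : nat) (x : R) : R := C n i * x ^ i * (1 - x) ^ (n - i).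

(* Hahn polynomial Q_m(x;a,b,N) = 3F2(-m, m+a+b+1, -x; a+1, -N; 1)
   (terminating: summed over k = 0..m). *)
Definition Hahn (m : nat) (x a b : R) (N : nat) : R :=
  sum_f_R0 (fun k =>
      poch (- INR m) k * poch (INR m + a + b + 1) k * poch (- x) k
      / (INR (fact k) * poch (a + 1) k * poch (- INR N) k)) m.

Definition inner (alpha beta : R) (f g : R -> R) : R :=
  epsilon (inhabits 0)
    (fun L => improper01
       (fun x => Rpower (1 - x) alpha * Rpower x beta * f x * g x) L).

Definition is_poly_le (n : nat) (f : R -> R) : Prop :=
  exists a : nat -> R, forall x, f x = sum_f_R0 (fun k => a k * x ^ k) n.

Definition DualBern (n : nat) (alpha beta : R) (i : nat) : R -> R :=
  epsilon (inhabits (fun _ : R => 0))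
    (fun f => is_poly_le n f /\
       forall j, (j <= n)%nat ->
         inner alpha beta f (Bern n j) = if Nat.eqb i j then 1 else 0).

(* (2m/sigma + 1) (sigma)_m, written as (2m+sigma)(sigma+1)_(m-1) for m>=1
   (identical when sigma <> 0; the continuous extension when sigma = 0). *)
Definition hahn_weight (sigma : R) (m : nat) : R :=
  match m with
  | O => 1
  | S m' => (2 * INR m + sigma) * poch (sigma + 1) m'
  end.

Definition coef1 (n : nat) (alpha beta : R) (i j : nat) : R :=
  let sigma := alpha + beta + 1 in
  / Beta (alpha + 1) (beta + 1) *
  sum_f_R0 (fun m =>
      hahn_weight sigma m * poch (beta + 1) m
      / (INR (fact m) * poch (alpha + 1) m)
      * Hahn m (INR i) beta alpha n * Hahn m (INR j) beta alpha n) n.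

Definition coef2 (n : nat) (alpha beta : R) (i j : nat) : R :=
  let sigma := alpha + beta + 1 in
  (-1) ^ n * poch (sigma + 1) n * poch (- alpha - INR n) i
  / (Beta (alpha + 1) (beta + 1) * INR (fact n) * poch (beta + 1) i) *
  sum_f_R0 (fun h =>
      poch (- INR i) h / poch (- alpha - INR n) h
      * Hahn (n - h) (INR (n - j)) alpha (beta + INR h + 1) n) i.

(* Main.v *)
From Coquelicot Require Import Rcomplements Hierarchy Continuity Derive RInt RInt_analysis AutoDerive.
Require Import Defs.
From Stdlib Require Import Reals Lra Lia FunctionalExtensionality.
Open Scope R_scope.

(* Write <f, g> for the inner product and G for the Gram matrix of the Bernstein
   basis.  The second family of coefficients is a left inverse of G: for fixed h
   the Hahn sum is the Bernstein form of a hypergeometric polynomial in 1 - x,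
   whose pairing with B^n_l is evaluated by Chu-Vandermonde and vanishes for
   h < l; the remaining sum over h is the binomial expansion of (1 - 1)^(i-l).
   As G is symmetric, this already yields a two-sided inverse, hence existence
   and uniqueness of the dual basis.  The first family is the expansion of D^n_i
   in the Jacobi polynomials R_m = sum_j Q_m(j; beta, alpha, n) B^n_j: both
   candidates have inner product Q_m(i) with every R_m, and the R_m span.

   The moments of the weight are explicit multiples of its total mass I(a, b),
   which is identified with Gamma(a+1) Gamma(b+1) / Gamma(a+b+2) by letting
   N -> oo in I(a, b) I(N, a+b+1) = I(N, a) I(a+N+1, b), using
   Gamma(b+1) / (N+b+2)^(b+1) <= I(N, b) <= Gamma(b+1) / N^(b+1). *)

(** * Improper integrals of nonnegative functions as suprema *)

(** [Gamma], [inner] and [DualBern] are values of a choice operator, so nothing can be said of them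
    before existence is proved. For the beta and gamma densities, which are nonnegative, existence
    reduces to a uniform bound on compact integrals; polynomials follow by linearity, because x^k
    (1-x)^l times the weight is again a beta density.

    The product identity with N stands in for the usual double integral: in terms of Gamma both
    sides are Gamma(N+1) Gamma(a+1) Gamma(b+1) / Gamma(N+a+b+3). For integer N it comes by induction
    from the one-step recurrences of I, in which Gamma does not occur; Gamma enters only through the
    growth of I(N, b).

    Pairings are computed with powers of 1-x wherever possible: against such a power both
    hypergeometric sums in play collapse to a 2F1 at 1, which Chu-Vandermonde evaluates. *)

Definition compact_integral (D : R -> Prop) (f : R -> R) (v : R) : Prop :=
  exists a b, D a /\ D b /\ a <= b /\ v = RInt f a b.

(** The first hypothesis says that [D] is an interval; the instances are (0,1) and (0,oo). *)
Lemma ex_RInt_on (D : R -> Prop) (f : R -> R) (a b : R) :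
  (forall x y z, D x -> D z -> x <= y <= z -> D y) ->
  (forall x, D x -> continuous f x) -> D a -> D b -> a <= b -> ex_RInt f a b.
Proof.
intros HD Hc Ha Hb Hab. apply (ex_RInt_continuous (V := R_CompleteNormedModule)). intros z Hz.
rewrite Rmin_left, Rmax_right in Hz by lra. apply Hc, (HD a z b); auto.
Qed.

Lemma RInt_subinterval (D : R -> Prop) (f : R -> R) (a p q b : R) :
  (forall x y z, D x -> D z -> x <= y <= z -> D y) ->
  (forall x, D x -> continuous f x) -> (forall x, D x -> 0 <= f x) ->
  D a -> D b -> a <= p -> p <= q -> q <= b -> RInt f p q <= RInt f a b.
Proof.
intros HD Hc Hp Ha Hb H1 H2 H3.
assert (Dp : D p) by (apply (HD a p b); auto; lra).
assert (Dq : D q) by (apply (HD a q b); auto; lra).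
assert (E : forall x y, D x -> D y -> x <= y -> ex_RInt f x y)
  by (intros; apply (ex_RInt_on D); auto).
assert (P : forall x y, D x -> D y -> x <= y -> 0 <= RInt f x y).
{ intros x y Dx Dy Hxy. apply RInt_ge_0; auto. intros z Hz. apply Hp, (HD x z y); auto; lra. }
rewrite <- (RInt_Chasles f a p b) by (apply E; auto; lra).
rewrite <- (RInt_Chasles f p q b) by (apply E; auto; lra).
unfold plus; simpl.
generalize (P a p Ha Dp H1) (P q b Dq Hb H3). lra.
Qed.

(** Nonnegativity makes the integral increase with the interval: once [p,q] comes within [eps] of
    the supremum, so does every larger interval. *)
Lemma lub_compact_integral_limit (D : R -> Prop) (f : R -> R) (L eps : R) :
  (forall x y z, D x -> D z -> x <= y <= z -> D y) ->
  (forall x, D x -> continuous f x) -> (forall x, D x -> 0 <= f x) ->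
  is_lub (compact_integral D f) L -> 0 < eps ->
  exists p q, D p /\ D q /\ p <= q /\
    forall a b, D a -> D b -> a <= p -> q <= b -> Rabs (RInt f a b - L) < eps.
Proof.
intros HD Hc Hp [Hub Hl] He.
destruct (classic (exists p q, D p /\ D q /\ p <= q /\ L - eps < RInt f p q)) as [[p [q [Dp [Dq [Hpq Hv]]]]]|N].
- exists p, q. repeat split; auto. intros a b Da Db Ha Hb.
  assert (RInt f p q <= RInt f a b) by (apply (RInt_subinterval D); auto).
  assert (RInt f a b <= L) by (apply Hub; exists a, b; repeat split; auto; lra).
  apply Rabs_def1; lra.
- assert (L <= L - eps); [|lra]. apply Hl. intros v [a [b [Da [Db [Hab ->]]]]].
  destruct (Rle_lt_dec (RInt f a b) (L - eps)); auto. exfalso; apply N. exists a, b; auto.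
Qed.

Lemma improper01_of_lub (f : R -> R) (L : R) :
  (forall x, 0 < x < 1 -> continuous f x) -> (forall x, 0 < x < 1 -> 0 <= f x) ->
  is_lub (compact_integral (fun x => 0 < x < 1) f) L -> improper01 f L.
Proof.
intros Hc Hp HL.
assert (HD : forall x y z : R, 0 < x < 1 -> 0 < z < 1 -> x <= y <= z -> 0 < y < 1) by (intros; lra).
split.
- intros a b Ha Hab Hb. constructor. apply ex_RInt_Reals_0.
  apply (ex_RInt_on (fun x => 0 < x < 1)); auto; lra.
- intros eps He.
  destruct (lub_compact_integral_limit _ f L eps HD Hc Hp HL He) as [p [q [Dp [Dq [Hpq H]]]]].
  exists (Rmin p (1 - q)). split. { apply Rmin_case; lra. }
  intros a b pr Ha Hb. rewrite <- RInt_Reals.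
  generalize (Rmin_l p (1 - q)) (Rmin_r p (1 - q)); intros. apply H; lra.
Qed.

Lemma improper0inf_of_lub (f : R -> R) (L : R) :
  (forall x, 0 < x -> continuous f x) -> (forall x, 0 < x -> 0 <= f x) ->
  is_lub (compact_integral (fun x => 0 < x) f) L -> improper0inf f L.
Proof.
intros Hc Hp HL.
assert (HD : forall x y z : R, 0 < x -> 0 < z -> x <= y <= z -> 0 < y) by (intros; lra).
split.
- intros a b Ha Hab. constructor. apply ex_RInt_Reals_0.
  apply (ex_RInt_on (fun x => 0 < x)); auto; lra.
- intros eps He.
  destruct (lub_compact_integral_limit _ f L eps HD Hc Hp HL He) as [p [q [Dp [Dq [Hpq H]]]]].
  exists p, q. split; auto.
  intros a b pr Ha Hb. rewrite <- RInt_Reals. apply H; lra.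
Qed.

Lemma eq_of_Rabs_lt (x y : R) : (forall eps, 0 < eps -> Rabs (x - y) < eps) -> x = y.
Proof.
intros H. apply Rminus_diag_uniq. apply NNPP; intros N.
specialize (H _ (Rabs_pos_lt _ N)). lra.
Qed.

Lemma Rabs_sub_triangle (v x y eps : R) :
  Rabs (v - x) < eps / 2 -> Rabs (v - y) < eps / 2 -> Rabs (x - y) < eps.
Proof.
intros H1 H2. apply Rabs_def2 in H1, H2. apply Rabs_def1; lra.
Qed.

Lemma improper01_unique (f : R -> R) (L L' : R) :
  improper01 f L -> improper01 f L' -> L = L'.
Proof.
intros [H1 H2] [_ H4]. apply eq_of_Rabs_lt. intros eps He.
destruct (H2 (eps / 2)) as [d [Hd K]]; [lra|].
destruct (H4 (eps / 2)) as [d' [Hd' K']]; [lra|].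
set (e := Rmin (Rmin d d') (1 / 2)).
assert (0 < e /\ e <= d /\ e <= d' /\ e <= 1 / 2) as [E0 [E1 [E2 E3]]].
{ unfold e. generalize (Rmin_l (Rmin d d') (1/2)) (Rmin_r (Rmin d d') (1/2))
   (Rmin_l d d') (Rmin_r d d'); intros. split; [|lra].
  repeat apply Rmin_case; lra. }
destruct (H1 (e / 2) (1 - e / 2)) as [pr]; try lra.
apply (Rabs_sub_triangle (RiemannInt pr)); [apply K | apply K']; lra.
Qed.

Lemma improper0inf_unique (f : R -> R) (L L' : R) :
  improper0inf f L -> improper0inf f L' -> L = L'.
Proof.
intros [H1 H2] [_ H4]. apply eq_of_Rabs_lt. intros eps He.
destruct (H2 (eps / 2)) as [d [M [Hd K]]]; [lra|].
destruct (H4 (eps / 2)) as [d' [M' [Hd' K']]]; [lra|].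
assert (0 < Rmin d d') by (apply Rmin_case; lra).
generalize (Rmin_l d d') (Rmin_r d d') (Rmax_l M M') (Rmax_r M M')
  (Rmax_l (Rmin d d') (Rmax M M')) (Rmax_r (Rmin d d') (Rmax M M')); intros.
(* [M] and [M'] may be negative; having [Rmin d d'] in the maximum keeps the endpoints in order. *)
destruct (H1 (Rmin d d' / 2) (Rmax (Rmin d d') (Rmax M M') + 1)) as [pr]; try lra.
apply (Rabs_sub_triangle (RiemannInt pr)); [apply K | apply K']; lra.
Qed.

Lemma improper01_ext (f g : R -> R) (L : R) :
  (forall x, 0 < x < 1 -> f x = g x) -> improper01 f L -> improper01 g L.
Proof.
intros E [H1 H2]. split.
- intros a b Ha Hab Hb. destruct (H1 a b Ha Hab Hb) as [pr]. constructor.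
  apply ex_RInt_Reals_0. apply ex_RInt_ext with f; [|apply ex_RInt_Reals_1; auto].
  intros x Hx. rewrite Rmin_left, Rmax_right in Hx by lra. apply E; lra.
- intros eps He. destruct (H2 eps He) as [d [Hd K]].
  (* The limit clause of [improper01] does not assume [a <= b]; the cap 1/2 enforces it. *)
  exists (Rmin d (1 / 2)). generalize (Rmin_l d (1 / 2)) (Rmin_r d (1 / 2)); intros.
  split. { apply Rmin_case; lra. }
  intros a b pr Ha Hb. destruct (H1 a b) as [pr']; try lra.
  specialize (K a b pr'). rewrite <- RInt_Reals in K |- *.
  rewrite (RInt_ext g f); [apply K; lra|].
  intros x Hx. rewrite Rmin_left, Rmax_right in Hx by lra. symmetry; apply E; lra.
Qed.

Lemma improper01_lin (f g : R -> R) (c d L M : R) :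
  improper01 f L -> improper01 g M ->
  improper01 (fun x => c * f x + d * g x) (c * L + d * M).
Proof.
intros [F1 F2] [G1 G2].
assert (E : forall a b, 0 < a -> a <= b -> b < 1 ->
   is_RInt (fun x => c * f x + d * g x) a b (c * RInt f a b + d * RInt g a b)).
{ intros a b Ha Hab Hb. destruct (F1 a b Ha Hab Hb) as [pf]. destruct (G1 a b Ha Hab Hb) as [pg].
  apply (is_RInt_plus (V := R_NormedModule) (fun x => c * f x) (fun x => d * g x)).
  - apply (is_RInt_scal (V := R_NormedModule) f). apply (RInt_correct (V := R_CompleteNormedModule)), ex_RInt_Reals_1, pf.
  - apply (is_RInt_scal (V := R_NormedModule) g). apply (RInt_correct (V := R_CompleteNormedModule)), ex_RInt_Reals_1, pg. }
split.
- intros a b Ha Hab Hb. constructor. apply ex_RInt_Reals_0. eexists. apply E; auto.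
(* The summand 1 keeps [k] positive when [c] and [d] both vanish. *)
- intros eps He. set (k := Rabs c + Rabs d + 1).
  assert (0 < k) by (unfold k; generalize (Rabs_pos c) (Rabs_pos d); lra).
  assert (Hk : 0 < eps / k) by (apply Rdiv_lt_0_compat; lra).
  destruct (F2 _ Hk) as [u [Hu KF]]. destruct (G2 _ Hk) as [v [Hv KG]].
  exists (Rmin (Rmin u v) (1 / 2)).
  generalize (Rmin_l (Rmin u v) (1/2)) (Rmin_r (Rmin u v) (1/2)) (Rmin_l u v) (Rmin_r u v); intros.
  split. { repeat apply Rmin_case; lra. }
  intros a b pr Ha Hb. rewrite <- RInt_Reals.
  rewrite (is_RInt_unique (V := R_CompleteNormedModule) _ _ _ _ (E a b ltac:(lra) ltac:(lra) ltac:(lra))).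
  destruct (F1 a b) as [pf]; try lra. destruct (G1 a b) as [pg]; try lra.
  specialize (KF a b pf ltac:(lra) ltac:(lra)). specialize (KG a b pg ltac:(lra) ltac:(lra)).
  rewrite <- RInt_Reals in KF, KG.
  replace (_ - _) with (c * (RInt f a b - L) + d * (RInt g a b - M)) by ring.
  eapply Rle_lt_trans; [apply Rabs_triang|]. rewrite !Rabs_mult.
  apply Rle_lt_trans with (Rabs c * (eps / k) + Rabs d * (eps / k)).
  + apply Rplus_le_compat; apply Rmult_le_compat_l; try apply Rabs_pos; lra.
  + set (e := eps / k) in *. replace eps with (k * e) by (unfold e; field; lra).
    unfold k. lra.
Qed.

Lemma improper01_derive (G g : R -> R) (l0 l1 : R) :
  (forall x, 0 < x < 1 -> is_derive G x (g x)) ->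
  (forall x, 0 < x < 1 -> continuous g x) ->
  (forall eps, 0 < eps -> exists d, 0 < d /\
     forall x, 0 < x < 1 -> x < d -> Rabs (G x - l0) < eps) ->
  (forall eps, 0 < eps -> exists d, 0 < d /\
     forall x, 0 < x < 1 -> 1 - d < x -> Rabs (G x - l1) < eps) ->
  improper01 g (l1 - l0).
Proof.
intros HG Hc H0 H1.
split.
- intros a b Ha Hab Hb. constructor. apply ex_RInt_Reals_0.
  apply (ex_RInt_on (fun x => 0 < x < 1)); auto; intros; lra.
- intros eps He. destruct (H0 (eps / 2)) as [u [Hu K0]]; [lra|].
  destruct (H1 (eps / 2)) as [v [Hv K1]]; [lra|].
  exists (Rmin (Rmin u v) (1 / 2)).
  generalize (Rmin_l (Rmin u v) (1/2)) (Rmin_r (Rmin u v) (1/2)) (Rmin_l u v) (Rmin_r u v); intros.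
  split. { repeat apply Rmin_case; lra. }
  intros a b pr Ha Hb. rewrite <- RInt_Reals.
  rewrite (is_RInt_unique (V := R_CompleteNormedModule) _ _ _ (minus (G b) (G a))).
  + specialize (K0 a ltac:(lra) ltac:(lra)). specialize (K1 b ltac:(lra) ltac:(lra)).
    apply Rabs_def2 in K0, K1. unfold minus, plus, opp; simpl. apply Rabs_def1; lra.
  + apply (is_RInt_derive (V := R_CompleteNormedModule)); intros x Hx; rewrite Rmin_left, Rmax_right in Hx by lra;
      [apply HG | apply Hc]; lra.
Qed.

(** * Euler's beta integral *)

Lemma exp_le (x y : R) : x <= y -> exp x <= exp y.
Proof. intros [H| ->]; [left; apply exp_increasing, H | right; reflexivity]. Qed.

Lemma Rpower_gt_0 (x c : R) : 0 < Rpower x c.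
Proof. apply exp_pos. Qed.

Lemma Rpower_base_one (c : R) : Rpower 1 c = 1.
Proof. unfold Rpower. rewrite ln_1, Rmult_0_r. apply exp_0. Qed.

Lemma Rpower_succ (x c : R) : 0 < x -> Rpower x (c + 1) = Rpower x c * x.
Proof. intros Hx. rewrite Rpower_plus, Rpower_1; auto. Qed.

Lemma Rpower_le_one (x c : R) : 0 < x <= 1 -> 0 <= c -> Rpower x c <= 1.
Proof.
intros Hx Hc. rewrite <- (Rpower_base_one c). apply Rle_Rpower_l; lra.
Qed.

Lemma Rpower_small (c eps : R) : 0 < c -> 0 < eps ->
  exists d, 0 < d /\ forall x, 0 < x -> x < d -> Rpower x c < eps.
Proof.
intros Hc He. exists (Rpower eps (/ c)). split; [apply Rpower_gt_0|].
intros x Hx Hd.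
replace eps with (Rpower (Rpower eps (/ c)) c).
- apply Rlt_Rpower_l; lra.
- rewrite Rpower_mult. replace (/ c * c) with 1 by (field; lra). apply Rpower_1; lra.
Qed.

Lemma is_derive_Rpower (x c : R) : 0 < x ->
  is_derive (fun x => Rpower x c) x (c * Rpower x (c - 1)).
Proof. intros Hx. apply is_derive_Reals, derivable_pt_lim_power, Hx. Qed.

Lemma is_derive_Rpower_rev (x c : R) : x < 1 ->
  is_derive (fun x => Rpower (1 - x) c) x (- (c * Rpower (1 - x) (c - 1))).
Proof.
intros Hx.
replace (- _) with (scal (-1) (c * Rpower (1 - x) (c - 1)))
  by (unfold scal; simpl; unfold mult; simpl; ring).
apply (is_derive_comp (fun y => Rpower y c) (fun x => 1 - x)).
- apply is_derive_Rpower; lra.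
- auto_derive; auto; ring.
Qed.

Lemma continuous_Rpower (x c : R) : 0 < x -> continuous (fun x => Rpower x c) x.
Proof. intros Hx. apply (ex_derive_continuous (V := R_NormedModule)). eexists; apply is_derive_Rpower, Hx. Qed.

Lemma continuous_Rpower_rev (x c : R) : x < 1 -> continuous (fun x => Rpower (1 - x) c) x.
Proof. intros Hx. apply (ex_derive_continuous (V := R_NormedModule)). eexists; apply is_derive_Rpower_rev, Hx. Qed.

Definition beta_density (a b x : R) : R := Rpower (1 - x) a * Rpower x b.

(** The total mass I(a, b); the first argument is the exponent of 1-x. It is kept apart from [Beta],
    which is built from [Gamma], until [betaI_Beta]. *)
Definition betaI (a b : R) : R := epsilon (inhabits 0) (improper01 (beta_density a b)).

Lemma beta_density_ge0 (a b x : R) : 0 <= beta_density a b x.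
Proof. apply Rmult_le_pos; apply Rlt_le, Rpower_gt_0. Qed.

Lemma continuous_beta_density (a b x : R) : 0 < x < 1 -> continuous (beta_density a b) x.
Proof.
intros Hx. apply (continuous_mult (fun x => Rpower (1 - x) a) (fun x => Rpower x b)).
- apply continuous_Rpower_rev; lra.
- apply continuous_Rpower; lra.
Qed.

Lemma beta_density_split (a b x : R) : 0 < x < 1 ->
  beta_density a b x = beta_density (a + 1) b x + beta_density a (b + 1) x.
Proof. intros Hx. unfold beta_density. rewrite !Rpower_succ by lra. ring. Qed.

(** Splitting by 1 = (1-x) + x raises one exponent to a positive value in each term. That factor is
    then at most 1, and what remains is x^b + (1-x)^a, with an explicit antiderivative. *)
Lemma RInt_beta_density_le (a b p q : R) : -1 < a -> -1 < b -> 0 < p -> p <= q -> q < 1 ->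
  RInt (beta_density a b) p q <= / (a + 1) + / (b + 1).
Proof.
intros Ha Hb Hp Hpq Hq.
set (G := fun x => Rpower x (b + 1) * / (b + 1) - Rpower (1 - x) (a + 1) * / (a + 1)).
assert (HG : is_RInt (fun x => Rpower x b + Rpower (1 - x) a) p q (minus (G q) (G p))).
{ apply (is_RInt_derive (V := R_CompleteNormedModule)); intros x Hx;
    rewrite Rmin_left, Rmax_right in Hx by lra.
  - replace (Rpower x b + _) with
      (minus ((b + 1) * Rpower x (b + 1 - 1) * / (b + 1))
             (- ((a + 1) * Rpower (1 - x) (a + 1 - 1)) * / (a + 1))).
    + apply (is_derive_minus (V := R_NormedModule)).
      * apply (is_derive_scal_l (V := R_NormedModule) (fun x => Rpower x (b + 1))).
        apply is_derive_Rpower; lra.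
      * apply (is_derive_scal_l (V := R_NormedModule) (fun x => Rpower (1 - x) (a + 1))).
        apply is_derive_Rpower_rev; lra.
    + replace (b + 1 - 1) with b by ring. replace (a + 1 - 1) with a by ring.
      unfold minus, plus, opp; simpl. field; lra.
  - apply (continuous_plus (V := R_NormedModule)).
    + apply continuous_Rpower; lra.
    + apply continuous_Rpower_rev; lra. }
apply Rle_trans with (RInt (fun x => Rpower x b + Rpower (1 - x) a) p q).
- apply RInt_le; auto.
  + apply (ex_RInt_on (fun x => 0 < x < 1)); try lra. intros; lra.
    intros; apply continuous_beta_density; auto.
  + eexists; apply HG.
  + intros x Hx. rewrite beta_density_split by lra. unfold beta_density.
    generalize (Rpower_le_one (1 - x) (a + 1) ltac:(lra) ltac:(lra))
      (Rpower_le_one x (b + 1) ltac:(lra) ltac:(lra)) (Rpower_gt_0 (1 - x) a) (Rpower_gt_0 x b).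
    intros. apply Rplus_le_compat; nra.
- rewrite (is_RInt_unique _ _ _ _ HG). unfold G, minus, plus, opp; simpl.
  assert (0 < / (a + 1)) by (apply Rinv_0_lt_compat; lra).
  assert (0 < / (b + 1)) by (apply Rinv_0_lt_compat; lra).
  generalize (Rpower_le_one (1 - p) (a + 1) ltac:(lra) ltac:(lra))
    (Rpower_le_one q (b + 1) ltac:(lra) ltac:(lra)) (Rpower_gt_0 (1 - q) (a + 1)) (Rpower_gt_0 p (b + 1)).
  intros.
  assert (Rpower q (b + 1) * / (b + 1) <= / (b + 1)) by nra.
  assert (Rpower (1 - p) (a + 1) * / (a + 1) <= / (a + 1)) by nra.
  assert (0 <= Rpower p (b + 1) * / (b + 1)) by nra.
  assert (0 <= Rpower (1 - q) (a + 1) * / (a + 1)) by nra.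
  lra.
Qed.

Lemma betaI_lub (a b : R) : -1 < a -> -1 < b ->
  improper01 (beta_density a b) (betaI a b) /\
  is_lub (compact_integral (fun x => 0 < x < 1) (beta_density a b)) (betaI a b).
Proof.
intros Ha Hb.
destruct (completeness (compact_integral (fun x => 0 < x < 1) (beta_density a b))) as [L HL].
- exists (/ (a + 1) + / (b + 1)). intros v [p [q [Hp [Hq [Hpq ->]]]]].
  apply RInt_beta_density_le; lra.
- exists (RInt (beta_density a b) (1/2) (1/2)), (1/2), (1/2). repeat split; lra.
- assert (HI : improper01 (beta_density a b) L).
  { apply improper01_of_lub; auto; intros.
    - apply continuous_beta_density; auto.
    - apply beta_density_ge0. }
  assert (E : improper01 (beta_density a b) (betaI a b)) by (apply (epsilon_spec _ (improper01 (beta_density a b))); eexists; apply HI).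
  rewrite (improper01_unique _ _ _ E HI) at 2. auto.
Qed.

Lemma betaI_improper (a b : R) : -1 < a -> -1 < b -> improper01 (beta_density a b) (betaI a b).
Proof. apply betaI_lub. Qed.

Lemma betaI_split (a b : R) : -1 < a -> -1 < b ->
  betaI a b = betaI (a + 1) b + betaI a (b + 1).
Proof.
intros Ha Hb. apply (improper01_unique (beta_density a b)).
- apply betaI_improper; auto.
- replace (_ + _) with (1 * betaI (a + 1) b + 1 * betaI a (b + 1)) by ring.
  apply (improper01_ext (fun x => 1 * beta_density (a + 1) b x + 1 * beta_density a (b + 1) x)).
  + intros x Hx. rewrite (beta_density_split a b) by auto. ring.
  + apply improper01_lin; apply betaI_improper; lra.
Qed.

(** The difference of the two sides integrates the derivative of (1-x)^(a+1) x^(b+1), which tends to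
    0 at both ends. *)
Lemma betaI_parts (a b : R) : -1 < a -> -1 < b ->
  (b + 1) * betaI (a + 1) b = (a + 1) * betaI a (b + 1).
Proof.
intros Ha Hb.
set (g := fun x => (b + 1) * beta_density (a + 1) b x + - (a + 1) * beta_density a (b + 1) x).
assert (H1 : improper01 g ((b + 1) * betaI (a + 1) b + - (a + 1) * betaI a (b + 1)))
  by (apply improper01_lin; apply betaI_improper; lra).
assert (H2 : improper01 g (0 - 0)).
{ apply (improper01_derive (beta_density (a + 1) (b + 1))).
  - intros x Hx.
    assert (K := is_derive_mult _ _ x _ _ (is_derive_Rpower_rev x (a + 1) (proj2 Hx))
      (is_derive_Rpower x (b + 1) (proj1 Hx))).
    replace (b + 1 - 1) with b in K by ring. replace (a + 1 - 1) with a in K by ring.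
    refine (eq_ind _ (is_derive _ x) K _ _). unfold g, beta_density.
    match goal with |- @eq _ ?u ?v => change (@eq R u v) end. ring.
  - intros x Hx. apply (continuous_plus (V := R_NormedModule));
      apply (continuous_scal_r (V := R_NormedModule)); apply continuous_beta_density; auto.
  - intros eps He. destruct (Rpower_small (b + 1) eps) as [d [Hd K]]; try lra.
    exists d. split; auto. intros x Hx Hxd. rewrite Rminus_0_r.
    rewrite Rabs_pos_eq by apply beta_density_ge0. unfold beta_density.
    generalize (Rpower_le_one (1 - x) (a + 1) ltac:(lra) ltac:(lra)) (K x ltac:(lra) ltac:(lra))
      (Rpower_gt_0 (1 - x) (a + 1)) (Rpower_gt_0 x (b + 1)). intros. nra.
  - intros eps He. destruct (Rpower_small (a + 1) eps) as [d [Hd K]]; try lra.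
    exists d. split; auto. intros x Hx Hxd. rewrite Rminus_0_r.
    rewrite Rabs_pos_eq by apply beta_density_ge0. unfold beta_density.
    generalize (Rpower_le_one x (b + 1) ltac:(lra) ltac:(lra)) (K (1 - x) ltac:(lra) ltac:(lra))
      (Rpower_gt_0 (1 - x) (a + 1)) (Rpower_gt_0 x (b + 1)). intros. nra. }
generalize (improper01_unique _ _ _ H1 H2). lra.
Qed.

(** [betaI_split] and [betaI_parts] are two linear equations for the two shifted integrals; this
    solves them. *)
Lemma betaI_succ_l (a b : R) : -1 < a -> -1 < b ->
  betaI (a + 1) b = (a + 1) / (a + b + 2) * betaI a b.
Proof.
intros Ha Hb. apply (Rmult_eq_reg_l (a + b + 2)); [|lra].
generalize (betaI_split a b Ha Hb) (betaI_parts a b Ha Hb); intros H1 H2.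
rewrite H1. field_simplify; [|lra]. lra.
Qed.

Lemma betaI_succ_r (a b : R) : -1 < a -> -1 < b ->
  betaI a (b + 1) = (b + 1) / (a + b + 2) * betaI a b.
Proof.
intros Ha Hb. apply (Rmult_eq_reg_l (a + b + 2)); [|lra].
generalize (betaI_split a b Ha Hb) (betaI_parts a b Ha Hb); intros H1 H2.
rewrite H1. field_simplify; [|lra]. lra.
Qed.

Lemma betaI_0_l (b : R) : -1 < b -> betaI 0 b = / (b + 1).
Proof.
intros Hb.
apply (improper01_unique (beta_density 0 b)); [apply betaI_improper; lra|].
assert (Hi : 0 < / (b + 1)) by (apply Rinv_0_lt_compat; lra).
replace (/ (b + 1)) with (/ (b + 1) - 0) by ring.
apply (improper01_derive (fun x => Rpower x (b + 1) * / (b + 1))).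
- intros x Hx. replace (beta_density 0 b x) with ((b + 1) * Rpower x (b + 1 - 1) * / (b + 1)).
  + apply (is_derive_scal_l (V := R_NormedModule) (fun x => Rpower x (b + 1))).
    apply is_derive_Rpower; lra.
  + unfold beta_density. rewrite Rpower_O by lra. replace (b + 1 - 1) with b by ring. field; lra.
- intros; apply continuous_beta_density; auto.
- intros eps He. destruct (Rpower_small (b + 1) (eps * (b + 1))) as [d [Hd K]]; try nra.
  exists d. split; auto. intros x Hx Hxd. rewrite Rminus_0_r.
  generalize (Rpower_gt_0 x (b + 1)) (K x ltac:(lra) Hxd); intros.
  rewrite Rabs_pos_eq by nra. apply Rmult_lt_reg_r with (b + 1); [lra|].
  rewrite Rmult_assoc, Rinv_l by lra. lra.
- intros eps He.
  assert (Hc := continuous_Rpower 1 (b + 1) ltac:(lra)).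
  assert (He' : 0 < eps * (b + 1)) by nra.
  assert (Hl := proj1 (filterlim_locally _ _) Hc (mkposreal _ He')).
  destruct Hl as [d Hd]. exists d. split; [apply cond_pos|].
  intros x Hx Hxd.
  assert (B : Rabs (Rpower x (b + 1) - 1) < eps * (b + 1)).
  { rewrite <- (Rpower_base_one (b + 1)) at 2. apply Hd.
    change (Rabs (x - 1) < d). apply Rabs_def1; lra. }
  replace (_ - _) with ((Rpower x (b + 1) - 1) * / (b + 1)) by ring.
  rewrite Rabs_mult, (Rabs_pos_eq (/ _)) by lra.
  apply Rmult_lt_reg_r with (b + 1); [lra|].
  rewrite Rmult_assoc, Rinv_l by lra. lra.
Qed.

(** Passing from n to n+1 multiplies both sides by the same rational factor, and the case n = 0 is a
    single recurrence step. *)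
Lemma betaI_mul (a b : R) (n : nat) : -1 < a -> -1 < b -> -1 < a + b + 1 ->
  betaI a b * betaI (INR n) (a + b + 1) = betaI (INR n) a * betaI (a + INR n + 1) b.
Proof.
intros Ha Hb Hab. induction n as [|n IH].
- simpl INR. rewrite !betaI_0_l, Rplus_0_r, betaI_succ_l by lra. field; lra.
- rewrite S_INR. assert (0 <= INR n) by apply pos_INR.
  replace (a + (INR n + 1) + 1) with ((a + INR n + 1) + 1) by ring.
  rewrite (betaI_succ_l (INR n) (a + b + 1)), (betaI_succ_l (INR n) a),
    (betaI_succ_l (a + INR n + 1) b) by lra.
  replace (betaI a b * _) with (betaI a b * betaI (INR n) (a + b + 1) * ((INR n + 1) / (INR n + (a + b + 1) + 2)))
    by ring.
  rewrite IH. field; lra.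
Qed.

(** * The Gamma integral squeezed between beta integrals *)

Definition gamma_density (b u : R) : R := Rpower u b * exp (- u).

Lemma continuous_gamma_density (b u : R) : 0 < u -> continuous (gamma_density b) u.
Proof.
intros Hu. apply (continuous_mult (fun u => Rpower u b) (fun u => exp (- u))).
- apply continuous_Rpower; auto.
- apply (ex_derive_continuous (V := R_NormedModule)). auto_derive; auto.
Qed.

Lemma gamma_density_ge0 (b u : R) : 0 <= gamma_density b u.
Proof. apply Rmult_le_pos; apply Rlt_le; apply exp_pos. Qed.

(* Substitute [u = M t / (1 - t)] with [M = N + b + 2] and use
   [exp (t / (1 - t)) >= 1 / (1 - t)]. *)
Lemma RInt_gamma_density_le (N b p q : R) : 0 <= N -> -1 < b -> 0 < p -> p <= q ->
  RInt (gamma_density b) p q <= Rpower (N + b + 2) (b + 1) * betaI N b.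
Proof.
intros HN Hb Hp Hpq. set (M := N + b + 2). assert (HM : 0 < M) by (unfold M; lra).
set (g := fun t => M * t / (1 - t)). set (dg := fun t => M * / ((1 - t) * (1 - t))).
(* The inverse substitution is t = u / (M + u). *)
set (r := p / (M + p)). set (s := q / (M + q)).
assert (Hr : 0 < r) by (apply Rdiv_lt_0_compat; lra).
assert (Hs : s < 1).
{ unfold s. apply Rmult_lt_reg_r with (M + q); [lra|]. unfold Rdiv.
  rewrite Rmult_assoc, Rinv_l; lra. }
assert (Hrs : r <= s).
{ unfold r, s. apply Rmult_le_reg_r with ((M + p) * (M + q)); [nra|].
  replace (p / (M + p) * _) with (p * (M + q)) by (field; lra).
  replace (q / (M + q) * _) with (q * (M + p)) by (field; lra). nra. }
replace p with (g r) by (unfold g, r; field; lra).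
replace q with (g s) by (unfold g, s; field; lra).
assert (HC : forall t, 0 < t < 1 -> 0 < g t).
{ intros t Ht. unfold g. apply Rdiv_lt_0_compat; nra. }
assert (Hcont : forall t, Rmin r s <= t <= Rmax r s -> continuous (gamma_density b) (g t)).
{ intros t Ht. rewrite Rmin_left, Rmax_right in Ht by lra.
  apply continuous_gamma_density, HC; lra. }
assert (Hder : forall t, Rmin r s <= t <= Rmax r s -> is_derive g t (dg t) /\ continuous dg t).
{ intros t Ht. rewrite Rmin_left, Rmax_right in Ht by lra. split.
  - unfold g, dg. auto_derive. lra. field; lra.
  - apply (ex_derive_continuous (V := R_NormedModule)). unfold dg. auto_derive. nra. }
rewrite <- (RInt_comp (V := R_CompleteNormedModule) (gamma_density b) g dg r s Hcont Hder).
assert (HE : forall c, ex_RInt (fun t => scal c (beta_density N b t)) r s).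
{ intros c. apply (ex_RInt_scal (V := R_NormedModule)).
  apply (ex_RInt_on (fun x => 0 < x < 1)); try lra. intros; lra.
  intros; apply continuous_beta_density; auto. }
apply Rle_trans with (RInt (fun t => scal (Rpower M (b + 1)) (beta_density N b t)) r s).
- apply RInt_le; auto.
  + eexists. apply (is_RInt_comp (V := R_CompleteNormedModule) (gamma_density b) g dg r s Hcont Hder).
  + intros t Ht. unfold scal; simpl; unfold mult; simpl. unfold gamma_density, beta_density, dg.
    assert (Ht1 : 0 < 1 - t) by lra.
    assert (X : exp (- g t) <= Rpower (1 - t) M).
    { replace (- g t) with (M * - (t / (1 - t))) by (unfold g; field; lra).
      replace (Rpower (1 - t) M) with (exp (M * ln (1 - t))) by reflexivity.
      assert (Hln : - (t / (1 - t)) <= ln (1 - t)).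
      { rewrite <- (Ropp_involutive (ln (1 - t))), <- ln_Rinv by lra. apply Ropp_le_contravar.
        rewrite <- (ln_exp (t / (1 - t))). apply ln_le.
        - apply Rinv_0_lt_compat; lra.
        - replace (/ (1 - t)) with (1 + t / (1 - t)) by (field; lra). apply exp_ineq1_le. }
      apply exp_le. nra. }
    replace (Rpower (g t) b) with (Rpower M b * Rpower t b * Rpower (/ (1 - t)) b).
    2:{ unfold g, Rdiv. rewrite !Rpower_mult_distr; auto; try nra; try lra.
        apply Rinv_0_lt_compat; lra. }
    rewrite Rpower_succ by auto.
    (* The power u^b and the Jacobian contribute (1-t)^(-b-2), which turns the exponent M into N;
       hence the choice of M. *)
    replace (Rpower (1 - t) N) with (Rpower (1 - t) M * Rpower (/ (1 - t)) b * / ((1 - t) * (1 - t))).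
    * set (A := Rpower (/ (1 - t)) b) in *. set (I := / ((1 - t) * (1 - t))).
      assert (0 < I) by (unfold I; apply Rinv_0_lt_compat; nra).
      assert (0 < A) by apply Rpower_gt_0.
      generalize (Rpower_gt_0 M b) (Rpower_gt_0 t b); intros.
      replace (M * I * (Rpower M b * Rpower t b * A * exp (- g t)))
        with ((M * Rpower M b * Rpower t b * A * I) * exp (- g t)) by ring.
      replace (Rpower M b * M * _) with ((M * Rpower M b * Rpower t b * A * I) * Rpower (1 - t) M) by ring.
      apply Rmult_le_compat_l; auto. repeat apply Rmult_le_pos; lra.
    * unfold M. rewrite !Rpower_plus. replace 2 with (1 + 1) by ring.
      rewrite Rpower_plus, Rpower_1 by lra.
      assert (E : Rpower (1 - t) b * Rpower (/ (1 - t)) b = 1).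
      { rewrite Rpower_mult_distr; auto. rewrite Rinv_r by lra. apply Rpower_base_one.
        apply Rinv_0_lt_compat; lra. }
      replace (Rpower (1 - t) N * Rpower (1 - t) b * ((1 - t) * (1 - t)) * Rpower (/ (1 - t)) b * / ((1 - t) * (1 - t)))
        with (Rpower (1 - t) N * (Rpower (1 - t) b * Rpower (/ (1 - t)) b)) by (field; lra).
      rewrite E; ring.
- rewrite (RInt_scal (V := R_CompleteNormedModule)).
  + apply Rmult_le_compat_l; [apply Rlt_le, Rpower_gt_0|].
    destruct (betaI_lub N b) as [_ [Hub _]]; try lra. apply Hub.
    exists r, s. repeat split; lra.
  + apply (ex_RInt_on (fun x => 0 < x < 1)); try lra. intros; lra.
    intros; apply continuous_beta_density; auto.
Qed.

Lemma Gamma_lub (b : R) : -1 < b ->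
  is_lub (compact_integral (fun x => 0 < x) (gamma_density b)) (Gamma (b + 1)).
Proof.
intros Hb.
destruct (completeness (compact_integral (fun x => 0 < x) (gamma_density b))) as [L HL].
(* Any N would do for boundedness; N = 0 is taken. *)
- exists (Rpower (0 + b + 2) (b + 1) * betaI 0 b). intros v [p [q [Hp [Hq [Hpq ->]]]]].
  apply RInt_gamma_density_le; lra.
- exists (RInt (gamma_density b) 1 1), 1, 1. repeat split; lra.
- assert (HI : improper0inf (gamma_density b) L).
  { apply improper0inf_of_lub; auto; intros.
    - apply continuous_gamma_density; auto.
    - apply gamma_density_ge0. }
  assert (E : improper0inf (gamma_density b) (Gamma (b + 1))).
  { unfold Gamma. replace (b + 1 - 1) with b by ring.
    exact (epsilon_spec (inhabits 0) (improper0inf (gamma_density b)) (ex_intro _ L HI)). }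
  rewrite (improper0inf_unique _ _ _ E HI). auto.
Qed.

Lemma Gamma_le_betaI (N b : R) : 0 <= N -> -1 < b ->
  Gamma (b + 1) <= Rpower (N + b + 2) (b + 1) * betaI N b.
Proof.
intros HN Hb. apply (Gamma_lub b Hb). intros v [p [q [Hp [Hq [Hpq ->]]]]].
apply RInt_gamma_density_le; lra.
Qed.

(** Substitute u = N t and use 1 - t <= exp(-t). *)
Lemma betaI_le_Gamma (N b : R) : 0 < N -> -1 < b ->
  Rpower N (b + 1) * betaI N b <= Gamma (b + 1).
Proof.
intros HN Hb.
assert (HP := Rpower_gt_0 N (b + 1)).
apply Rmult_le_reg_l with (/ Rpower N (b + 1)); [apply Rinv_0_lt_compat; auto|].
rewrite <- Rmult_assoc, Rinv_l, Rmult_1_l by lra.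
apply (betaI_lub N b); [lra|lra|]. intros v [p [q [Hp [Hq [Hpq ->]]]]].
apply Rmult_le_reg_l with (Rpower N (b + 1)); auto.
rewrite <- Rmult_assoc, Rinv_r, Rmult_1_l by lra.
assert (HE : ex_RInt (beta_density N b) p q).
{ apply (ex_RInt_on (fun x => 0 < x < 1)); try lra. intros; lra.
  intros; apply continuous_beta_density; auto. }
apply Rle_trans with (RInt (gamma_density b) (N * p) (N * q)).
2:{ apply (Gamma_lub b Hb). exists (N * p), (N * q). repeat split; nra. }
assert (Hcont : forall t, Rmin p q <= t <= Rmax p q -> continuous (gamma_density b) (N * t)).
{ intros t Ht. rewrite Rmin_left, Rmax_right in Ht by lra. apply continuous_gamma_density; nra. }
assert (Hder : forall t, Rmin p q <= t <= Rmax p q ->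
   is_derive (fun t => N * t) t N /\ continuous (fun _ => N) t).
{ intros t Ht. split.
  - auto_derive; auto; ring.
  - apply continuous_const. }
rewrite <- (RInt_comp (V := R_CompleteNormedModule) (gamma_density b) (fun t => N * t) (fun _ => N) p q Hcont Hder).
replace (Rpower N (b + 1) * RInt (beta_density N b) p q)
  with (RInt (fun t => scal (Rpower N (b + 1)) (beta_density N b t)) p q)
  by (apply (RInt_scal (V := R_CompleteNormedModule)); auto).
apply RInt_le; auto.
- apply (ex_RInt_scal (V := R_NormedModule)); auto.
- eexists. apply (is_RInt_comp (V := R_CompleteNormedModule) (gamma_density b) (fun t => N * t) (fun _ => N) p q Hcont Hder).
- intros t Ht. unfold scal; simpl; unfold mult; simpl. unfold gamma_density, beta_density.
  rewrite Rpower_succ, <- Rpower_mult_distr by lra.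
  assert (X : Rpower (1 - t) N <= exp (- (N * t))).
  { replace (- (N * t)) with (N * - t) by ring.
    apply exp_le. apply Rmult_le_compat_l; [lra|].
    rewrite <- (ln_exp (- t)). apply ln_le; [lra|].
    generalize (exp_ineq1_le (- t)); lra. }
  generalize (Rpower_gt_0 N b) (Rpower_gt_0 t b); intros.
  replace (Rpower N b * N * _) with (N * Rpower N b * Rpower t b * Rpower (1 - t) N) by ring.
  replace (N * (_ * _)) with (N * Rpower N b * Rpower t b * exp (- (N * t))) by ring.
  apply Rmult_le_compat_l; auto. repeat apply Rmult_le_pos; lra.
Qed.

Lemma Gamma_gt_0 (b : R) : -1 < b -> 0 < Gamma (b + 1).
Proof.
intros Hb. apply Rlt_le_trans with (Rpower 1 (b + 1) * betaI 1 b).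
- replace (betaI 1 b) with (betaI (0 + 1) b) by (f_equal; ring).
  rewrite betaI_succ_l, betaI_0_l by lra.
  apply Rmult_lt_0_compat; [apply Rpower_gt_0|].
  apply Rmult_lt_0_compat; [apply Rdiv_lt_0_compat|apply Rinv_0_lt_compat]; lra.
- apply betaI_le_Gamma; lra.
Qed.

(** The limit N -> oo in multiplicative form: if U exceeded W, some n would satisfy c / (n+1) <
    ln(U/W). *)
Lemma le_of_le_exp (U W c : R) : 0 < W -> 0 < c ->
  (forall n, U <= exp (c / INR (S n)) * W) -> U <= W.
Proof.
intros HW Hc H. destruct (Rle_lt_dec U W) as [|HU]; auto. exfalso.
assert (1 < U / W).
{ apply Rmult_lt_reg_r with W; auto. unfold Rdiv. rewrite Rmult_assoc, Rinv_l; lra. }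
assert (Hl : 0 < ln (U / W)) by (rewrite <- ln_1; apply ln_increasing; lra).
destruct (archimed_cor1 (ln (U / W) / c)) as [n [Hn Hn0]]; [apply Rdiv_lt_0_compat; auto|].
destruct n as [|n]; [lia|].
specialize (H n). assert (Hp : 0 < INR (S n)) by (apply lt_0_INR; lia).
assert (exp (c / INR (S n)) < U / W).
{ rewrite <- (exp_ln (U / W)) by lra. apply exp_increasing.
  apply Rmult_lt_reg_r with (/ c); [apply Rinv_0_lt_compat; auto|].
  unfold Rdiv in Hn |- *. replace (c * / INR (S n) * / c) with (/ INR (S n)) by (field; lra). auto. }
assert (exp (c / INR (S n)) * W < U).
{ replace U with (U / W * W) at 1 by (field; lra). nra. }
lra.
Qed.

(** Bounding every factor of [betaI_mul] other than I(a, b) by Gamma values compares U = I(a, b)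
    Gamma(s) with W = Gamma(a+1) Gamma(b+1) in both directions, up to the factor ((N+s+1)/N)^s <=
    exp(s(s+1)/N). *)
Lemma betaI_Beta (a b : R) : -1 < a -> -1 < b -> betaI a b = Beta (a + 1) (b + 1).
Proof.
intros Ha Hb. set (s := a + b + 2).
assert (Ga := Gamma_gt_0 a Ha). assert (Gb := Gamma_gt_0 b Hb).
assert (Gs : 0 < Gamma s).
{ replace s with (a + b + 1 + 1) by (unfold s; ring). apply Gamma_gt_0; lra. }
unfold Beta. replace (a + 1 + (b + 1)) with s by (unfold s; ring).
set (W := Gamma (a + 1) * Gamma (b + 1)). set (U := betaI a b * Gamma s).
assert (HW : 0 < W) by (unfold W; nra).
assert (HV : 0 <= betaI a b).
{ apply Rle_trans with (RInt (beta_density a b) (1/2) (1/2)).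
  - apply RInt_ge_0; [lra| |intros; apply beta_density_ge0].
    apply (ex_RInt_point (V := R_NormedModule)).
  - apply (betaI_lub a b Ha Hb). exists (1/2), (1/2). repeat split; lra. }
assert (Hs : 0 < s) by (unfold s; lra).
assert (H : forall n, U <= exp (s * (s + 1) / INR (S n)) * W /\ W <= exp (s * (s + 1) / INR (S n)) * U).
{ intros n. set (N := INR (S n)). assert (HN : 1 <= N) by (unfold N; rewrite S_INR; generalize (pos_INR n); lra).
  assert (M := betaI_mul a b (S n) Ha Hb ltac:(lra)). fold N in M.
  set (X := betaI N a) in *. set (Y := betaI (a + N + 1) b) in *. set (Z := betaI N (a + b + 1)) in *.
  assert (X1 := betaI_le_Gamma N a ltac:(lra) Ha). assert (X2 := Gamma_le_betaI N a ltac:(lra) Ha).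
  assert (Y1 := betaI_le_Gamma (a + N + 1) b ltac:(lra) Hb).
  assert (Y2 := Gamma_le_betaI (a + N + 1) b ltac:(lra) Hb).
  assert (Z1 := betaI_le_Gamma N (a + b + 1) ltac:(lra) ltac:(lra)).
  assert (Z2 := Gamma_le_betaI N (a + b + 1) ltac:(lra) ltac:(lra)).
  fold X in X1, X2. fold Y in Y1, Y2. fold Z in Z1, Z2.
  replace (a + b + 1 + 1) with s in Z1, Z2 by (unfold s; ring).
  replace (N + (a + b + 1) + 2) with (N + s + 1) in Z2 by (unfold s; ring).
  replace (a + N + 1 + b + 2) with (N + s + 1) in Y2 by (unfold s; ring).
  assert (HT : Rpower (N + s + 1) s <= exp (s * (s + 1) / N) * Rpower N s).
  { replace (N + s + 1) with ((1 + (s + 1) / N) * N) by (field; lra).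
    assert (0 < (s + 1) / N) by (apply Rdiv_lt_0_compat; lra).
    rewrite <- Rpower_mult_distr by lra.
    apply Rmult_le_compat_r; [apply Rlt_le, Rpower_gt_0|].
    unfold Rpower. apply exp_le. replace (s * (s + 1) / N) with (s * ((s + 1) / N)) by (field; lra).
    apply Rmult_le_compat_l; [lra|]. rewrite <- (ln_exp ((s + 1) / N)) at 2.
    apply ln_le; [lra|]. apply exp_ineq1_le. }
  assert (HP : Rpower N s = Rpower N (a + 1) * Rpower N (b + 1))
    by (rewrite <- Rpower_plus; f_equal; unfold s; ring).
  assert (HP' : Rpower (N + s + 1) s = Rpower (N + s + 1) (a + 1) * Rpower (N + s + 1) (b + 1))
    by (rewrite <- Rpower_plus; f_equal; unfold s; ring).
  assert (P0 := Rpower_gt_0 N s). assert (P1 := Rpower_gt_0 N (a + 1)). assert (P2 := Rpower_gt_0 N (b + 1)).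
  assert (T0 := Rpower_gt_0 (N + s + 1) s).
  assert (T1 := Rpower_gt_0 (N + s + 1) (a + 1)). assert (T2 := Rpower_gt_0 (N + s + 1) (b + 1)).
  assert (HX : 0 < X).
  { apply Rmult_lt_reg_l with (Rpower (N + a + 2) (a + 1)); [apply Rpower_gt_0|]. lra. }
  assert (HY : 0 < Y).
  { apply Rmult_lt_reg_l with (Rpower (N + s + 1) (b + 1)); auto. lra. }
  (* The bases are moved to the common extremes N and N+s+1, so that the powers with exponents a+1
     and b+1 multiply to an s-th power. *)
  assert (Y1' : Rpower N (b + 1) * Y <= Gamma (b + 1)).
  { eapply Rle_trans; [|apply Y1]. apply Rmult_le_compat_r; [lra|]. apply Rle_Rpower_l; lra. }
  assert (X2' : Gamma (a + 1) <= Rpower (N + s + 1) (a + 1) * X).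
  { eapply Rle_trans; [apply X2|]. apply Rmult_le_compat_r; [lra|].
    apply Rle_Rpower_l; [lra|]. unfold s; lra. }
  split; apply Rmult_le_reg_l with (Rpower N s); auto.
  - apply Rle_trans with (Rpower (N + s + 1) s * W).
    2:{ rewrite <- Rmult_assoc, (Rmult_comm (Rpower N s)). apply Rmult_le_compat_r; lra. }
    apply Rle_trans with (Rpower (N + s + 1) s * ((Rpower N (a + 1) * X) * (Rpower N (b + 1) * Y))).
    + replace (_ * ((_ * X) * _)) with (Rpower N s * betaI a b * (Rpower (N + s + 1) s * Z)).
      * unfold U. rewrite <- Rmult_assoc. apply Rmult_le_compat_l; auto. apply Rmult_le_pos; lra.
      * rewrite HP.
        transitivity (Rpower (N + s + 1) s * Rpower N (a + 1) * Rpower N (b + 1) * (betaI a b * Z)); [ring|].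
        rewrite M. ring.
    + apply Rmult_le_compat_l; [lra|]. unfold W. apply Rmult_le_compat; auto; apply Rmult_le_pos; lra.
  - apply Rle_trans with (Rpower (N + s + 1) s * U).
    2:{ rewrite <- Rmult_assoc, (Rmult_comm (Rpower N s)). apply Rmult_le_compat_r; [|lra].
        unfold U; apply Rmult_le_pos; lra. }
    apply Rle_trans with (Rpower N s * ((Rpower (N + s + 1) (a + 1) * X) * (Rpower (N + s + 1) (b + 1) * Y))).
    + apply Rmult_le_compat_l; [lra|]. unfold W. apply Rmult_le_compat; lra.
    + replace (_ * ((_ * X) * _)) with (Rpower (N + s + 1) s * betaI a b * (Rpower N s * Z)).
      * unfold U. rewrite <- (Rmult_assoc (Rpower (N + s + 1) s)).
        apply Rmult_le_compat_l; auto. apply Rmult_le_pos; lra.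
      * rewrite HP'.
        transitivity (Rpower N s * Rpower (N + s + 1) (a + 1) * Rpower (N + s + 1) (b + 1) * (betaI a b * Z)); [ring|].
        rewrite M. ring. }
(* So far I(a, b) is only known to be nonnegative; the inequality bounding W > 0 by a multiple of U
   makes it strict. *)
assert (HU : 0 < U).
{ destruct (H 0%nat) as [_ H0]. assert (E := exp_pos (s * (s + 1) / INR 1)). nra. }
assert (U = W).
{ apply Rle_antisym; apply (le_of_le_exp _ _ (s * (s + 1))); auto; try nra; apply H. }
apply Rmult_eq_reg_r with (Gamma s); [|lra]. fold U. rewrite H0. field; lra.
Qed.

(** * Pochhammer symbols, Hahn and Bernstein polynomials *)

Lemma sum_exchange (f : nat -> nat -> R) (n m : nat) :
  sum_f_R0 (fun i => sum_f_R0 (fun j => f i j) m) n = sum_f_R0 (fun j => sum_f_R0 (fun i => f i j) n) m.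
Proof.
induction n as [|n IH]; simpl; auto. rewrite IH, <- sum_plus. reflexivity.
Qed.

Lemma sum_zero_tail (f : nat -> R) (n m : nat) : (n <= m)%nat ->
  (forall k, (n < k <= m)%nat -> f k = 0) -> sum_f_R0 f m = sum_f_R0 f n.
Proof.
intros H. induction H as [|m H IH]; intros K; auto.
rewrite tech5, IH, K by (intros; try apply K; lia). ring.
Qed.

Lemma sum_zero (f : nat -> R) (n : nat) : (forall k, (k <= n)%nat -> f k = 0) -> sum_f_R0 f n = 0.
Proof.
intros H. rewrite (sum_zero_tail f 0 n); [apply H; lia|lia|]. intros; apply H; lia.
Qed.

Lemma sum_S_l (f : nat -> R) (n : nat) :
  sum_f_R0 f (S n) = f 0%nat + sum_f_R0 (fun k => f (S k)) n.
Proof. apply (decomp_sum f (S n)). lia. Qed.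

Lemma sum_zero_head (f : nat -> R) (l n : nat) : (l <= n)%nat ->
  (forall k, (k < l)%nat -> f k = 0) -> sum_f_R0 f n = sum_f_R0 (fun k => f (l + k)%nat) (n - l).
Proof.
revert f n. induction l as [|l IH]; intros f n H K.
- rewrite Nat.sub_0_r. reflexivity.
- destruct n as [|n]; [lia|]. rewrite sum_S_l, K, Rplus_0_l by lia.
  rewrite (IH (fun k => f (S k))) by (intros; try apply K; lia). reflexivity.
Qed.

Lemma sum_single (f : nat -> R) (i n : nat) : (i <= n)%nat ->
  (forall k, (k <= n)%nat -> k <> i -> f k = 0) -> sum_f_R0 f n = f i.
Proof.
intros H K. rewrite (sum_zero_tail f i n); auto; [|intros; apply K; lia].
rewrite (sum_zero_head f i i); auto; [|intros; apply K; lia].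
rewrite Nat.sub_diag. simpl. f_equal; lia.
Qed.

Lemma sum_rev (f : nat -> R) (n : nat) : sum_f_R0 f n = sum_f_R0 (fun k => f (n - k)%nat) n.
Proof.
revert f. induction n as [|n IH]; intros f; auto.
rewrite tech5, sum_S_l, IH, Nat.sub_0_r, Rplus_comm. reflexivity.
Qed.

Lemma sum_scal_l (c : R) (f : nat -> R) (n : nat) :
  c * sum_f_R0 f n = sum_f_R0 (fun k => c * f k) n.
Proof. rewrite scal_sum. apply sum_eq; intros; ring. Qed.

Lemma sum_scal_r (c : R) (f : nat -> R) (n : nat) :
  sum_f_R0 f n * c = sum_f_R0 (fun k => f k * c) n.
Proof. rewrite Rmult_comm, scal_sum. reflexivity. Qed.

Lemma poch_S_l (c : R) (k : nat) : poch c (S k) = c * poch (c + 1) k.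
Proof.
induction k as [|k IH]; [simpl; ring|].
change (poch c (S (S k))) with (poch c (S k) * (c + INR (S k))). rewrite IH, S_INR. simpl. ring.
Qed.

Lemma poch_add (c : R) (k l : nat) : poch c (k + l) = poch c k * poch (c + INR k) l.
Proof.
induction l as [|l IH].
- rewrite Nat.add_0_r. simpl. ring.
- rewrite Nat.add_succ_r. simpl. rewrite IH, plus_INR. ring.
Qed.

Lemma poch_gt_0 (c : R) (k : nat) : 0 < c -> 0 < poch c k.
Proof.
intros Hc. induction k as [|k IH]; simpl; [lra|]. generalize (pos_INR k). intros. nra.
Qed.

Lemma poch_opp_INR_eq0 (n k : nat) : (n < k)%nat -> poch (- INR n) k = 0.
Proof.
intros H. induction H; simpl.
- ring.
- rewrite IHle. ring.
Qed.

Lemma poch_opp_INR_fact (n k : nat) : (k <= n)%nat ->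
  poch (- INR n) k * INR (fact (n - k)) = (-1) ^ k * INR (fact n).
Proof.
induction k as [|k IH]; intros H; [rewrite Nat.sub_0_r; simpl; ring|].
change (poch (- INR n) (S k)) with (poch (- INR n) k * (- INR n + INR k)).
replace (fact (n - k)) with ((n - k) * fact (n - S k))%nat in IH.
- rewrite mult_INR, minus_INR in IH by lia. simpl pow.
  rewrite (Rmult_assoc (-1)), <- IH by lia. ring.
- replace (n - k)%nat with (S (n - S k)) by lia. reflexivity.
Qed.

Lemma poch_opp_INR_neq0 (n k : nat) : (k <= n)%nat -> poch (- INR n) k <> 0.
Proof.
intros H E. assert (K := poch_opp_INR_fact n k H). rewrite E, Rmult_0_l in K.
symmetry in K. apply Rmult_integral in K. destruct K as [K|K].
- apply (pow_nonzero (-1) k); lra.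
- apply (INR_fact_neq_0 _ K).
Qed.

Lemma sign_sqr (n : nat) : (-1) ^ n * (-1) ^ n = 1.
Proof. rewrite <- Rpow_mult_distr. replace (-1 * -1) with 1 by ring. apply pow1. Qed.

(** The last h factors of (a+1)_n, read downwards, are those of (-a-n)_h up to sign. This explains
    the parameter -alpha-n in the second family. *)
Lemma poch_reverse (a : R) (n h : nat) : (h <= n)%nat ->
  poch (a + 1) n = poch (a + 1) (n - h) * ((-1) ^ h * poch (- a - INR n) h).
Proof.
induction h as [|h IH]; intros H; [rewrite Nat.sub_0_r; simpl; ring|].
rewrite IH by lia. replace (n - h)%nat with (S (n - S h)) by lia.
simpl poch. rewrite minus_INR, S_INR by lia. simpl pow. ring.
Qed.

(* Induction on [n] from the contiguous relation
   [F (n+1) b c = F n b c - (b/c) F n (b+1) (c+1)]. *)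
Lemma chu_vandermonde (n : nat) (b c : R) : 0 < c ->
  sum_f_R0 (fun k => poch (- INR n) k * poch b k / (INR (fact k) * poch c k)) n
  = poch (c - b) n / poch c n.
Proof.
revert b c. induction n as [|n IH]; intros b c Hc; [simpl; field|].
transitivity (sum_f_R0 (fun k => poch (- INR n) k * poch b k / (INR (fact k) * poch c k)) (S n)
  + - (b / c) * sum_f_R0 (fun k => poch (- INR n) k * poch (b + 1) k / (INR (fact k) * poch (c + 1) k)) n).
- rewrite !sum_S_l, sum_scal_l. simpl (poch _ 0).
  rewrite Rplus_assoc, <- sum_plus. f_equal. apply sum_eq. intros k Hk.
  assert (P := poch_gt_0 (c + 1) k ltac:(lra)). assert (F := INR_fact_neq_0 k).
  assert (F' : INR (S k) <> 0) by (apply not_0_INR; lia).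
  rewrite fact_simpl, mult_INR, (poch_S_l b), (poch_S_l c), (poch_S_l (- INR (S n))).
  replace (- INR (S n) + 1) with (- INR n) by (rewrite S_INR; ring).
  change (poch (- INR n) (S k)) with (poch (- INR n) k * (- INR n + INR k)).
  rewrite !S_INR in *. field. repeat split; lra.
(* The extra term k = n+1 carries (-n)_(n+1) = 0, so both sums are instances of the induction
   hypothesis. *)
- rewrite tech5, IH, IH, poch_opp_INR_eq0 by (lia || lra).
  replace (c + 1 - (b + 1)) with (c - b) by ring.
  assert (P := poch_gt_0 c n Hc). assert (P' := poch_gt_0 (c + 1) n ltac:(lra)).
  assert (P'' := poch_gt_0 c (S n) Hc).
  assert (E : poch (c + 1) n = poch c n * (c + INR n) / c).
  { apply Rmult_eq_reg_l with c; [|lra]. rewrite <- poch_S_l. simpl. field; lra. }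
  rewrite E. simpl poch. generalize (pos_INR n); intros.
  unfold Rdiv at 2. rewrite !Rmult_0_l. field. lra.
Qed.

(** This is (1-1)^n, obtained as Chu-Vandermonde with b = c = 1, whose numerator is (0)_n. *)
Lemma sum_poch_opp_INR (n : nat) :
  sum_f_R0 (fun k => poch (- INR n) k / INR (fact k)) n = if Nat.eqb n 0 then 1 else 0.
Proof.
rewrite (sum_eq _ (fun k => poch (- INR n) k * poch 1 k / (INR (fact k) * poch 1 k))).
- rewrite chu_vandermonde by lra. assert (P := poch_gt_0 1 n ltac:(lra)).
  destruct n as [|n]; simpl Nat.eqb; cbv iota; [simpl; field|].
  replace (1 - 1) with (- INR 0) by (simpl; ring). rewrite poch_opp_INR_eq0 by lia.
  field; lra.
- intros k _. assert (P := poch_gt_0 1 k ltac:(lra)). assert (F := INR_fact_neq_0 k). field; lra.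
Qed.

(** * Bernstein sums and the Bernstein form of Hahn polynomials *)

Lemma C_absorb (n j : nat) : (j <= n)%nat ->
  INR (S j) * Binomial.C (S n) (S j) = INR (S n) * Binomial.C n j.
Proof.
intros H. unfold Binomial.C. rewrite Nat.sub_succ, !fact_simpl, !mult_INR.
assert (INR (S j) <> 0) by (apply not_0_INR; lia).
assert (F1 := INR_fact_neq_0 j). assert (F2 := INR_fact_neq_0 (n - j)). field; lra.
Qed.

Lemma sum_Bern (n : nat) (x : R) : sum_f_R0 (fun j => Bern n j x) n = 1.
Proof.
unfold Bern. rewrite <- binomial. replace (x + (1 - x)) with 1 by ring. apply pow1.
Qed.

(** Up to the sign (-1)^k, these are the factorial moments of the binomial distribution. Absorbing
    one factor j into the binomial coefficient extracts -n x and lowers the degree, so [n] stays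
    general in the induction on [k]. *)
Lemma sum_poch_Bern (n k : nat) (x : R) :
  sum_f_R0 (fun j => poch (- INR j) k * Bern n j x) n = poch (- INR n) k * x ^ k.
Proof.
revert n. induction k as [|k IH]; intros n.
- simpl poch. transitivity (sum_f_R0 (fun j => Bern n j x) n).
  + apply sum_eq; intros; ring.
  + rewrite sum_Bern. simpl; ring.
- destruct n as [|n].
  + change (sum_f_R0 _ 0) with (poch (- INR 0) (S k) * Bern 0 0 x).
    rewrite poch_opp_INR_eq0 by lia. ring.
  + rewrite sum_S_l, (poch_opp_INR_eq0 0), Rmult_0_l, Rplus_0_l by lia.
    rewrite (poch_S_l (- INR (S n))).
    replace (- INR (S n) + 1) with (- INR n) by (rewrite S_INR; ring).
    replace (_ * _ * x ^ S k) with ((- INR (S n) * x) * (poch (- INR n) k * x ^ k)) by (simpl; ring).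
    rewrite <- IH, sum_scal_l. apply sum_eq. intros j Hj.
    rewrite poch_S_l. replace (- INR (S j) + 1) with (- INR j) by (rewrite S_INR; ring).
    unfold Bern. rewrite Nat.sub_succ. simpl pow.
    transitivity (- (INR (S j) * Binomial.C (S n) (S j)) * (poch (- INR j) k * (x * x ^ j * (1 - x) ^ (n - j)))).
    * ring.
    * rewrite C_absorb by auto. ring.
Qed.

Lemma Bern_reflect (n j : nat) (x : R) : (j <= n)%nat -> Bern n (n - j) x = Bern n j (1 - x).
Proof.
intros H. unfold Bern. rewrite <- pascal_step1 by auto.
replace (n - (n - j))%nat with j by lia. replace (1 - (1 - x)) with x by ring. ring.
Qed.

Lemma sum_poch_Bern_reflect (n k : nat) (x : R) :
  sum_f_R0 (fun j => poch (- INR (n - j)) k * Bern n j x) n = poch (- INR n) k * (1 - x) ^ k.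
Proof.
rewrite <- sum_poch_Bern, sum_rev. apply sum_eq. intros j Hj.
rewrite Bern_reflect by auto. replace (n - (n - j))%nat with j by lia. reflexivity.
Qed.

(** 2F1(-m, m+a+b+1; a+1; x), that is, the Jacobi polynomial P_m^(a,b)(1-2x) normalized to 1 at x =
    0. The R_m of the overview is [jacobi m b a] for the weight (1-x)^a x^b. *)
Definition jacobi (m : nat) (a b x : R) : R :=
  sum_f_R0 (fun k => poch (- INR m) k * poch (INR m + a + b + 1) k
    / (INR (fact k) * poch (a + 1) k) * x ^ k) m.

(** A Hahn polynomial depends on its argument through (-q)_k only, and the moment (-n)_k y^k cancels
    the denominator (-n)_k. Keeping [q] and [y] abstract covers both j and n-j. *)
Lemma sum_Hahn_Bern_of_moments (m n : nat) (a b x y : R) (q : nat -> nat) : (m <= n)%nat -> -1 < a ->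
  (forall k, sum_f_R0 (fun j => poch (- INR (q j)) k * Bern n j x) n = poch (- INR n) k * y ^ k) ->
  sum_f_R0 (fun j => Hahn m (INR (q j)) a b n * Bern n j x) n = jacobi m a b y.
Proof.
intros Hm Ha H. unfold Hahn, jacobi.
rewrite (sum_eq _ (fun j => sum_f_R0 (fun k => poch (- INR m) k * poch (INR m + a + b + 1) k * poch (- INR (q j)) k
      / (INR (fact k) * poch (a + 1) k * poch (- INR n) k) * Bern n j x) m))
  by (intros; apply sum_scal_r).
rewrite sum_exchange. apply sum_eq. intros k Hk.
assert (P := poch_opp_INR_neq0 n k ltac:(lia)). assert (P' := poch_gt_0 (a + 1) k ltac:(lra)).
assert (F := INR_fact_neq_0 k).
transitivity (poch (- INR m) k * poch (INR m + a + b + 1) k / (INR (fact k) * poch (a + 1) k * poch (- INR n) k)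
  * (poch (- INR n) k * y ^ k)).
- rewrite <- H, sum_scal_l. apply sum_eq. intros j Hj. field. repeat split; auto; lra.
- field. repeat split; auto; lra.
Qed.

Lemma sum_Hahn_Bern (m n : nat) (a b x : R) : (m <= n)%nat -> -1 < a ->
  sum_f_R0 (fun j => Hahn m (INR j) a b n * Bern n j x) n = jacobi m a b x.
Proof.
intros Hm Ha. apply (sum_Hahn_Bern_of_moments m n a b x x (fun j => j)); auto.
intros; apply sum_poch_Bern.
Qed.

Lemma sum_Hahn_Bern_reflect (m n : nat) (a b x : R) : (m <= n)%nat -> -1 < a ->
  sum_f_R0 (fun j => Hahn m (INR (n - j)) a b n * Bern n j x) n = jacobi m a b (1 - x).
Proof.
intros Hm Ha. apply (sum_Hahn_Bern_of_moments m n a b x (1 - x) (fun j => (n - j)%nat)); auto.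
intros; apply sum_poch_Bern_reflect.
Qed.

(** * Polynomials and the moments of the weight *)

Lemma is_poly_le_mono (n m : nat) (f : R -> R) : (n <= m)%nat -> is_poly_le n f -> is_poly_le m f.
Proof.
intros H [a Ha]. exists (fun k => if (k <=? n)%nat then a k else 0). intros x.
rewrite Ha, (sum_zero_tail _ n m); auto.
- apply sum_eq. intros k Hk. apply Nat.leb_le in Hk. rewrite Hk. reflexivity.
- intros k Hk. replace (k <=? n)%nat with false; [ring|]. symmetry. apply Nat.leb_gt. lia.
Qed.

Lemma is_poly_le_lin (n : nat) (c d : R) (f g : R -> R) :
  is_poly_le n f -> is_poly_le n g -> is_poly_le n (fun x => c * f x + d * g x).
Proof.
intros [a Ha] [b Hb]. exists (fun k => c * a k + d * b k). intros x.
rewrite Ha, Hb, !sum_scal_l, <- sum_plus. apply sum_eq; intros; ring.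
Qed.

Lemma is_poly_le_sum (n m : nat) (c : nat -> R) (f : nat -> R -> R) :
  (forall k, (k <= m)%nat -> is_poly_le n (f k)) ->
  is_poly_le n (fun x => sum_f_R0 (fun k => c k * f k x) m).
Proof.
induction m as [|m IH]; intros H.
- destruct (is_poly_le_lin n (c 0%nat) 0 _ _ (H 0%nat ltac:(lia)) (H 0%nat ltac:(lia))) as [a Ha].
  exists a. intros x. rewrite <- Ha. simpl. ring.
- destruct (is_poly_le_lin n 1 (c (S m)) _ _ (IH ltac:(auto with arith)) (H (S m) ltac:(lia))) as [a Ha].
  exists a. intros x. rewrite <- Ha. simpl. ring.
Qed.

Lemma is_poly_le_mul_X (n : nat) (f : R -> R) : is_poly_le n f -> is_poly_le (S n) (fun x => x * f x).
Proof.
intros [a Ha]. exists (fun k => match k with O => 0 | S k => a k end). intros x.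
rewrite sum_S_l, Ha, sum_scal_l, Rmult_0_l, Rplus_0_l. apply sum_eq; intros; simpl; ring.
Qed.

Lemma is_poly_le_mul_1X (n : nat) (f : R -> R) : is_poly_le n f -> is_poly_le (S n) (fun x => (1 - x) * f x).
Proof.
intros H. destruct (is_poly_le_lin (S n) 1 (-1) f (fun x => x * f x)) as [a Ha].
- apply (is_poly_le_mono n); auto.
- apply is_poly_le_mul_X, H.
- exists a. intros x. rewrite <- Ha. ring.
Qed.

Lemma is_poly_le_monomial (k l : nat) : is_poly_le (k + l) (fun x => x ^ k * (1 - x) ^ l).
Proof.
induction k as [|k IH].
- induction l as [|l IH].
  + exists (fun _ => 1). intros x. simpl. ring.
  + destruct (is_poly_le_mul_1X _ _ IH) as [a Ha]. exists a. intros x.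
    simpl plus. rewrite <- Ha. simpl. ring.
- destruct (is_poly_le_mul_X _ _ IH) as [a Ha]. exists a. intros x.
  simpl plus. rewrite <- Ha. simpl. ring.
Qed.

Lemma is_poly_le_Bern (n j : nat) : (j <= n)%nat -> is_poly_le n (Bern n j).
Proof.
intros H. assert (M := is_poly_le_monomial j (n - j)). replace (j + (n - j))%nat with n in M by lia.
destruct (is_poly_le_lin n (Binomial.C n j) 0 _ _ M M) as [a Ha].
exists a. intros x. rewrite <- Ha. unfold Bern. ring.
Qed.

Lemma is_poly_le_mul (n m : nat) (f g : R -> R) :
  is_poly_le n f -> is_poly_le m g -> is_poly_le (n + m) (fun x => f x * g x).
Proof.
intros [a Ha] Hg.
destruct (is_poly_le_sum (n + m) n a (fun k x => x ^ k * g x)) as [b Hb].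
- intros k Hk. apply (is_poly_le_mono (k + m)); [lia|]. clear Hk. induction k as [|k IH].
  + destruct Hg as [c Hc]. exists c. intros x. simpl plus. rewrite <- Hc. simpl. ring.
  + destruct (is_poly_le_mul_X _ _ IH) as [c Hc]. exists c. intros x. simpl plus. rewrite <- Hc. simpl. ring.
- exists b. intros x. rewrite <- Hb, Ha, sum_scal_r. apply sum_eq; intros; ring.
Qed.

(** Read backwards, [sum_poch_Bern] expands x^k with coefficients (-j)_k / (-n)_k, defined because k
    <= n. *)
Lemma is_poly_le_Bern_expand (n : nat) (f : R -> R) : is_poly_le n f ->
  exists p, forall x, f x = sum_f_R0 (fun j => p j * Bern n j x) n.
Proof.
intros [a Ha].
exists (fun j => sum_f_R0 (fun k => a k / poch (- INR n) k * poch (- INR j) k) n). intros x.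
rewrite (sum_eq _ (fun j => sum_f_R0 (fun k => a k / poch (- INR n) k * poch (- INR j) k * Bern n j x) n))
  by (intros; apply sum_scal_r).
rewrite Ha, sum_exchange. apply sum_eq. intros k Hk.
transitivity (a k / poch (- INR n) k * (poch (- INR n) k * x ^ k)).
- field. apply poch_opp_INR_neq0; auto.
- rewrite <- sum_poch_Bern, sum_scal_l. apply sum_eq; intros; ring.
Qed.

(** Re-expansion around x = 1. Only the leading coefficient is recorded, since orthogonality
    annihilates the contribution of the others. *)
Lemma pow_sum_reflect (n : nat) (a : nat -> R) : exists u : nat -> R,
  (forall x, sum_f_R0 (fun k => a k * x ^ k) n = sum_f_R0 (fun k => u k * (1 - x) ^ k) n) /\
  u n = (-1) ^ n * a n.
Proof.
revert a. induction n as [|n IH]; intros a.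
- exists a. split; [intros; simpl; ring|simpl; ring].
- destruct (IH (fun k => a (S k))) as [u [Hu Hn]].
  (* From x f = f - (1-x) f with f already expanded; the test discards [u (S n)], on which the
     induction hypothesis gives no control. *)
  exists (fun k => match k with O => a 0%nat + u 0%nat | S k => (if (S k <=? n)%nat then u (S k) else 0) - u k end).
  split.
  + intros x. rewrite (sum_S_l (fun k => a k * x ^ k)).
    rewrite (sum_eq _ (fun k => (a (S k) * x ^ k) * x)) by (intros; simpl; ring).
    rewrite <- sum_scal_r, Hu.
    transitivity (a 0%nat + sum_f_R0 (fun k => (if (k <=? n)%nat then u k else 0) * (1 - x) ^ k) (S n)
      - (1 - x) * sum_f_R0 (fun k => u k * (1 - x) ^ k) n).
    * rewrite (sum_zero_tail _ n (S n)); [|lia|].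
      -- rewrite (sum_eq (fun k => (if (k <=? n)%nat then u k else 0) * (1 - x) ^ k) (fun k => u k * (1 - x) ^ k)).
         ++ ring.
         ++ intros k Hk. apply Nat.leb_le in Hk. rewrite Hk. reflexivity.
      -- intros k Hk. replace (k <=? n)%nat with false; [ring|]. symmetry. apply Nat.leb_gt. lia.
    * rewrite !sum_S_l, sum_scal_l. simpl (0 <=? n)%nat. cbv iota.
      unfold Rminus at 1.
      replace (- sum_f_R0 (fun k => (1 - x) * (u k * (1 - x) ^ k)) n)
        with (sum_f_R0 (fun k => - ((1 - x) * (u k * (1 - x) ^ k))) n).
      -- rewrite !Rplus_assoc, <- sum_plus. simpl pow. rewrite <- (Rplus_assoc (a 0%nat)).
         rewrite Rmult_plus_distr_r, !Rmult_1_r. rewrite !Rplus_assoc. do 2 f_equal.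
         apply sum_eq. intros; simpl pow; ring.
      -- replace (- sum_f_R0 (fun k => (1 - x) * (u k * (1 - x) ^ k)) n)
           with (-1 * sum_f_R0 (fun k => (1 - x) * (u k * (1 - x) ^ k)) n) by ring.
         rewrite sum_scal_l. apply sum_eq; intros; ring.
  + replace (S n <=? n)%nat with false by (symmetry; apply Nat.leb_gt; lia). rewrite Hn. simpl. ring.
Qed.

(** * Integration of polynomials against the weight *)

Definition wint (a b : R) (f : R -> R) : R :=
  epsilon (inhabits 0) (improper01 (fun x => beta_density a b x * f x)).

(** Says that the value chosen by [wint] really is the improper integral. *)
Definition w_integrable (a b : R) (f : R -> R) : Prop :=
  improper01 (fun x => beta_density a b x * f x) (wint a b f).

Lemma inner_wint (a b : R) (f g : R -> R) : inner a b f g = wint a b (fun x => f x * g x).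
Proof.
unfold inner, wint, beta_density.
apply (f_equal (fun F => epsilon (inhabits 0) (improper01 F))).
apply functional_extensionality; intros x. ring.
Qed.

Lemma w_integrable_intro (a b : R) (f : R -> R) (L : R) :
  improper01 (fun x => beta_density a b x * f x) L -> w_integrable a b f /\ wint a b f = L.
Proof.
intros H. assert (S : w_integrable a b f).
{ apply (epsilon_spec _ (improper01 (fun x => beta_density a b x * f x))). eexists; apply H. }
split; auto. apply (improper01_unique _ _ _ S H).
Qed.

Lemma wint_ext (a b : R) (f g : R -> R) : (forall x, f x = g x) -> wint a b f = wint a b g.
Proof. intros H. f_equal. apply functional_extensionality, H. Qed.

Lemma wint_lin (a b c d : R) (f g : R -> R) : w_integrable a b f -> w_integrable a b g ->
  w_integrable a b (fun x => c * f x + d * g x) /\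
  wint a b (fun x => c * f x + d * g x) = c * wint a b f + d * wint a b g.
Proof.
intros Hf Hg. apply w_integrable_intro.
apply (improper01_ext (fun x => c * (beta_density a b x * f x) + d * (beta_density a b x * g x))).
- intros; ring.
- apply improper01_lin; auto.
Qed.

Lemma wint_sum (a b : R) (n : nat) (c : nat -> R) (f : nat -> R -> R) :
  (forall k, (k <= n)%nat -> w_integrable a b (f k)) ->
  w_integrable a b (fun x => sum_f_R0 (fun k => c k * f k x) n) /\
  wint a b (fun x => sum_f_R0 (fun k => c k * f k x) n) = sum_f_R0 (fun k => c k * wint a b (f k)) n.
Proof.
induction n as [|n IH]; intros H.
- destruct (wint_lin a b (c 0%nat) 0 _ _ (H 0%nat ltac:(lia)) (H 0%nat ltac:(lia))) as [S E].
  replace (fun x => sum_f_R0 (fun k => c k * f k x) 0) with (fun x => c 0%nat * f 0%nat x + 0 * f 0%nat x)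
    by (apply functional_extensionality; intros; simpl; ring).
  split; auto. rewrite E. simpl. ring.
- destruct IH as [S E]; [auto with arith|].
  destruct (wint_lin a b 1 (c (Datatypes.S n)) _ _ S (H (Datatypes.S n) ltac:(lia))) as [S' E'].
  replace (fun x => sum_f_R0 (fun k => c k * f k x) (Datatypes.S n))
    with (fun x => 1 * sum_f_R0 (fun k => c k * f k x) n + c (Datatypes.S n) * f (Datatypes.S n) x)
    by (apply functional_extensionality; intros; simpl; ring).
  split; auto. rewrite E', E. simpl. ring.
Qed.

Lemma betaI_shift (a b : R) (k l : nat) : -1 < a -> -1 < b ->
  betaI (a + INR l) (b + INR k) =
  betaI a b * (poch (b + 1) k * poch (a + 1) l / poch (a + b + 2) (k + l)).
Proof.
intros Ha Hb. induction k as [|k IH].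
- induction l as [|l IH]; [simpl; rewrite !Rplus_0_r; field|].
  generalize (pos_INR l); intros Hl. assert (P := poch_gt_0 (a + b + 2) l ltac:(lra)).
  replace (a + INR (S l)) with (a + INR l + 1) by (rewrite S_INR; ring).
  rewrite betaI_succ_l, IH by (simpl INR; lra). simpl plus. simpl. field. lra.
- generalize (pos_INR l) (pos_INR k); intros Hl Hk.
  assert (P := poch_gt_0 (a + b + 2) (k + l) ltac:(lra)).
  replace (b + INR (S k)) with (b + INR k + 1) by (rewrite S_INR; ring).
  rewrite betaI_succ_r, IH by lra. simpl. rewrite plus_INR. field. lra.
Qed.

Lemma wint_monomial (a b : R) (k l : nat) : -1 < a -> -1 < b ->
  w_integrable a b (fun x => x ^ k * (1 - x) ^ l) /\
  wint a b (fun x => x ^ k * (1 - x) ^ l) =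
  betaI a b * (poch (b + 1) k * poch (a + 1) l / poch (a + b + 2) (k + l)).
Proof.
intros Ha Hb. apply w_integrable_intro. rewrite <- betaI_shift by auto.
generalize (pos_INR l) (pos_INR k); intros Hl Hk.
apply (improper01_ext (beta_density (a + INR l) (b + INR k))).
- intros x Hx. unfold beta_density. rewrite !Rpower_plus, !Rpower_pow by lra. ring.
- apply betaI_improper; lra.
Qed.

Lemma is_poly_le_w_integrable (a b : R) (n : nat) (f : R -> R) : -1 < a -> -1 < b ->
  is_poly_le n f -> w_integrable a b f.
Proof.
intros Ha Hb [p Hp].
replace f with (fun x => sum_f_R0 (fun k => p k * x ^ k) n)
  by (apply functional_extensionality; intros; rewrite Hp; reflexivity).
apply (wint_sum a b n p (fun k x => x ^ k)). intros k _.
replace (fun x => x ^ k) with (fun x => x ^ k * (1 - x) ^ 0)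
  by (apply functional_extensionality; intros; simpl; ring).
apply wint_monomial; auto.
Qed.

Lemma wint_mul_sum (a b : R) (n m l : nat) (c : nat -> R) (f : nat -> R -> R) (g : R -> R) :
  -1 < a -> -1 < b -> (forall k, (k <= n)%nat -> is_poly_le m (f k)) -> is_poly_le l g ->
  wint a b (fun x => sum_f_R0 (fun k => c k * f k x) n * g x) =
  sum_f_R0 (fun k => c k * wint a b (fun x => f k x * g x)) n.
Proof.
intros Ha Hb Hf Hg.
rewrite <- (proj2 (wint_sum a b n c (fun k x => f k x * g x) ltac:(
  intros; apply (is_poly_le_w_integrable a b (m + l)); auto; apply is_poly_le_mul; auto))).
apply wint_ext. intros x. rewrite sum_scal_r. apply sum_eq; intros; ring.
Qed.

(** * The dual basis *)

Lemma wint_scal (a b c : R) (n : nat) (f : R -> R) : -1 < a -> -1 < b -> is_poly_le n f ->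
  wint a b (fun x => c * f x) = c * wint a b f.
Proof.
intros Ha Hb Hf. apply (is_poly_le_w_integrable a b) in Hf; auto.
transitivity (wint a b (fun x => c * f x + 0 * f x)); [apply wint_ext; intros; ring|].
rewrite (proj2 (wint_lin a b c 0 f f Hf Hf)). ring.
Qed.

Lemma wint_comm (a b : R) (f g : R -> R) : wint a b (fun x => f x * g x) = wint a b (fun x => g x * f x).
Proof. apply wint_ext; intros; ring. Qed.

Lemma betaI_gt_0 (a b : R) : -1 < a -> -1 < b -> 0 < betaI a b.
Proof.
intros Ha Hb. rewrite betaI_Beta by auto. unfold Beta.
replace (a + 1 + (b + 1)) with (a + b + 1 + 1) by ring.
generalize (Gamma_gt_0 a Ha) (Gamma_gt_0 b Hb) (Gamma_gt_0 (a + b + 1) ltac:(lra)); intros.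
apply Rdiv_lt_0_compat; nra.
Qed.

Lemma is_poly_le_pow_1X (n k : nat) : (k <= n)%nat -> is_poly_le n (fun x => (1 - x) ^ k).
Proof.
intros H. apply (is_poly_le_mono k); auto.
destruct (is_poly_le_monomial 0 k) as [p Hp]. exists p. intros x.
simpl plus in Hp. rewrite <- Hp. simpl. ring.
Qed.

Lemma is_poly_le_jacobi (n m : nat) (a b : R) : (m <= n)%nat -> is_poly_le n (jacobi m a b).
Proof.
intros H. apply (is_poly_le_mono m); auto. eexists. intros x. reflexivity.
Qed.

Lemma is_poly_le_jacobi_reflect (m : nat) (a b : R) : is_poly_le m (fun x => jacobi m a b (1 - x)).
Proof.
unfold jacobi. apply (is_poly_le_sum m m _ (fun k x => (1 - x) ^ k)).
intros; apply is_poly_le_pow_1X; auto.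
Qed.

Lemma wint_pow_1X_Bern (a b : R) (n l k : nat) : -1 < a -> -1 < b -> (l <= n)%nat ->
  wint a b (fun x => (1 - x) ^ k * Bern n l x) =
  betaI a b * (Binomial.C n l * (poch (b + 1) l * poch (a + 1) (n - l + k) / poch (a + b + 2) (n + k))).
Proof.
intros Ha Hb Hl.
transitivity (wint a b (fun x => Binomial.C n l * (x ^ l * (1 - x) ^ (n - l + k)))).
- apply wint_ext. intros x. unfold Bern. rewrite pow_add. ring.
- rewrite (wint_scal a b _ (l + (n - l + k))) by (auto; apply is_poly_le_monomial).
  rewrite (proj2 (wint_monomial a b l (n - l + k) Ha Hb)).
  replace (l + (n - l + k))%nat with (n + k)%nat by lia. ring.
Qed.

(** Termwise integration leaves 2F1(-(n-h), a+1+n-l; a+1; 1). The resulting factor (-(n-l))_(n-h)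
    vanishes exactly when h < l. *)
Lemma wint_jacobi_reflect_Bern (a b : R) (n h l : nat) : -1 < a -> -1 < b -> (h <= n)%nat -> (l <= n)%nat ->
  wint a b (fun x => jacobi (n - h) a (b + INR h + 1) (1 - x) * Bern n l x) =
  betaI a b * (Binomial.C n l * (poch (b + 1) l * poch (a + 1) (n - l) / poch (a + b + 2) n))
  * (poch (- INR (n - l)) (n - h) / poch (a + 1) (n - h)).
Proof.
intros Ha Hb Hh Hl. unfold jacobi.
rewrite (wint_mul_sum a b (n - h) (n - h) n _ (fun k x => (1 - x) ^ k) (Bern n l));
  auto; [|intros; apply is_poly_le_pow_1X; auto|apply is_poly_le_Bern; auto].
replace (- INR (n - l)) with (a + 1 - (a + 1 + INR (n - l))) by ring.
rewrite <- chu_vandermonde, sum_scal_l by lra. apply sum_eq. intros k Hk.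
rewrite wint_pow_1X_Bern by auto. rewrite !poch_add.
(* The shift b+h+1 compensates the degree n-h: the upper parameter no longer depends on h and
   cancels (a+b+2+n)_k from the moments. *)
replace (INR (n - h) + a + (b + INR h + 1) + 1) with (a + b + 2 + INR n) by (rewrite minus_INR by auto; ring).
assert (P1 := poch_gt_0 (a + 1) k ltac:(lra)). assert (P2 := poch_gt_0 (a + b + 2) n ltac:(lra)).
assert (P3 := poch_gt_0 (a + b + 2 + INR n) k ltac:(generalize (pos_INR n); lra)).
assert (F := INR_fact_neq_0 k). field. repeat split; lra.
Qed.

(** For h >= l, (-(n-l))_(n-h) is (-1)^(n-h) (n-l)! / (h-l)!, and (-i)_h splits off (-i)_l. The
    signs combine to (-1)^n, and [sum_poch_opp_INR] at i-l remains. *)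
Lemma sum_poch_opp_dual (n i l : nat) : (i <= n)%nat -> (l <= n)%nat ->
  sum_f_R0 (fun h => poch (- INR i) h * (-1) ^ h * poch (- INR (n - l)) (n - h)) i =
  if Nat.eqb i l then (-1) ^ n * (-1) ^ i * INR (fact i) * INR (fact (n - i)) else 0.
Proof.
intros Hi Hl. destruct (Nat.le_gt_cases l i) as [H|H].
- rewrite (sum_zero_head _ l i); auto.
  2:{ intros h Hh. rewrite (poch_opp_INR_eq0 (n - l)) by lia. ring. }
  transitivity (poch (- INR i) l * (-1) ^ n * INR (fact (n - l)) *
    sum_f_R0 (fun h => poch (- INR (i - l)) h / INR (fact h)) (i - l)).
  + rewrite sum_scal_l. apply sum_eq. intros h Hh.
    assert (K := poch_opp_INR_fact (n - l) (n - (l + h)) ltac:(lia)).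
    replace (n - l - (n - (l + h)))%nat with h in K by lia.
    assert (F := INR_fact_neq_0 h).
    replace (poch (- INR (n - l)) (n - (l + h))) with ((-1) ^ (n - (l + h)) * INR (fact (n - l)) / INR (fact h))
      by (rewrite <- K; field; auto).
    rewrite poch_add. replace (- INR i + INR l) with (- INR (i - l)) by (rewrite minus_INR by auto; ring).
    replace ((-1) ^ n) with ((-1) ^ (l + h) * (-1) ^ (n - (l + h))) by (rewrite <- pow_add; f_equal; lia).
    field. auto.
  + rewrite sum_poch_opp_INR. destruct (Nat.eqb_spec i l) as [<-|N].
    * rewrite Nat.sub_diag. simpl Nat.eqb. cbv iota.
      assert (K := poch_opp_INR_fact i i (le_n i)). rewrite Nat.sub_diag in K. simpl (fact 0) in K.
      simpl (INR 1) in K. rewrite Rmult_1_r in K. rewrite K. ring.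
    * replace (Nat.eqb (i - l) 0) with false by (symmetry; apply Nat.eqb_neq; lia). ring.
- destruct (Nat.eqb_spec i l) as [E|_]; [lia|]. apply sum_zero. intros h Hh.
  rewrite (poch_opp_INR_eq0 (n - l)) by lia. ring.
Qed.

Definition dual2 (n : nat) (a b : R) (i : nat) (x : R) : R :=
  sum_f_R0 (fun j => coef2 n a b i j * Bern n j x) n.

Lemma poch_opp_sub_neq0 (a : R) (n h : nat) : -1 < a -> (h <= n)%nat -> poch (- a - INR n) h <> 0.
Proof.
intros Ha Hh E. assert (K := poch_reverse a n h Hh). rewrite E in K.
assert (P := poch_gt_0 (a + 1) n ltac:(lra)). lra.
Qed.

Lemma dual2_jacobi (n : nat) (a b : R) (i : nat) (x : R) : -1 < a -> -1 < b -> (i <= n)%nat ->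
  dual2 n a b i x =
  sum_f_R0 (fun h => (-1) ^ n * poch (a + b + 2) n * poch (- a - INR n) i
    / (betaI a b * INR (fact n) * poch (b + 1) i) * (poch (- INR i) h / poch (- a - INR n) h)
    * jacobi (n - h) a (b + INR h + 1) (1 - x)) i.
Proof.
intros Ha Hb Hi. unfold dual2, coef2. rewrite <- betaI_Beta by auto.
replace (a + b + 1 + 1) with (a + b + 2) by ring.
set (K := (-1) ^ n * _ * _ / _).
rewrite (sum_eq _ (fun j => sum_f_R0 (fun h => K * (poch (- INR i) h / poch (- a - INR n) h)
    * (Hahn (n - h) (INR (n - j)) a (b + INR h + 1) n * Bern n j x)) i)).
- rewrite sum_exchange. apply sum_eq. intros h Hh. rewrite <- sum_scal_l.
  rewrite sum_Hahn_Bern_reflect by (auto; lia). reflexivity.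
- intros j Hj. rewrite sum_scal_l, sum_scal_r. apply sum_eq; intros; ring.
Qed.

Lemma wint_dual2_Bern (n : nat) (a b : R) (i l : nat) : -1 < a -> -1 < b -> (i <= n)%nat -> (l <= n)%nat ->
  wint a b (fun x => dual2 n a b i x * Bern n l x) = if Nat.eqb i l then 1 else 0.
Proof.
intros Ha Hb Hi Hl.
assert (B := betaI_gt_0 a b Ha Hb).
assert (P0 := poch_gt_0 (a + 1) n ltac:(lra)). assert (P1 := poch_gt_0 (b + 1) i ltac:(lra)).
assert (P2 := poch_gt_0 (a + b + 2) n ltac:(lra)). assert (F := INR_fact_neq_0 n).
set (K := (-1) ^ n * poch (a + b + 2) n * poch (- a - INR n) i / (betaI a b * INR (fact n) * poch (b + 1) i)).
transitivity (K * (betaI a b * (Binomial.C n l * (poch (b + 1) l * poch (a + 1) (n - l) / poch (a + b + 2) n)))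
  / poch (a + 1) n * sum_f_R0 (fun h => poch (- INR i) h * (-1) ^ h * poch (- INR (n - l)) (n - h)) i).
- rewrite (wint_ext a b _ (fun x => sum_f_R0 (fun h => K * (poch (- INR i) h / poch (- a - INR n) h)
    * jacobi (n - h) a (b + INR h + 1) (1 - x)) i * Bern n l x))
    by (intros x; rewrite dual2_jacobi by auto; reflexivity).
  rewrite (wint_mul_sum a b i n n _ (fun h x => jacobi (n - h) a (b + INR h + 1) (1 - x)) (Bern n l)); auto.
  + rewrite sum_scal_l. apply sum_eq. intros h Hh. rewrite wint_jacobi_reflect_Bern by (auto; lia).
    assert (N := poch_opp_sub_neq0 a n h Ha ltac:(lia)).
    assert (P3 := poch_gt_0 (a + 1) (n - h) ltac:(lra)).
    (* Reversal turns 1 / ((-a-n)_h (a+1)_(n-h)) into (-1)^h / (a+1)_n, whose denominator is free of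
       h. *)
    rewrite (poch_reverse a n h) by lia.
    assert (E : (-1) ^ h * (-1) ^ h = 1) by apply sign_sqr.
    assert (E0 : (-1) ^ h <> 0) by (apply pow_nonzero; lra).
    field. repeat split; auto; lra.
  + intros h Hh. apply (is_poly_le_mono (n - h)); [lia|]. apply is_poly_le_jacobi_reflect.
  + apply is_poly_le_Bern; auto.
- rewrite sum_poch_opp_dual by auto. destruct (Nat.eqb_spec i l) as [<-|_]; [|ring].
  rewrite (poch_reverse a n i) by auto. unfold K, Binomial.C.
  assert (N := poch_opp_sub_neq0 a n i Ha Hi). assert (P3 := poch_gt_0 (a + 1) (n - i) ltac:(lra)).
  assert (F1 := INR_fact_neq_0 i). assert (F2 := INR_fact_neq_0 (n - i)).
  assert (E0 : (-1) ^ i <> 0) by (apply pow_nonzero; lra).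
  assert (E : (-1) ^ n * (-1) ^ n = 1) by apply sign_sqr.
  (* All factors cancel except two signs, one from the prefactor and one from the sum over h. *)
  transitivity ((-1) ^ n * (-1) ^ n); auto. field. repeat split; auto; lra.
Qed.

Lemma is_poly_le_Bern_sum (n : nat) (c : nat -> R) : is_poly_le n (fun x => sum_f_R0 (fun j => c j * Bern n j x) n).
Proof. apply is_poly_le_sum. intros; apply is_poly_le_Bern; auto. Qed.

(** Here the one-sided inverse becomes two-sided: pairing the sum with [dual2 n a b i] gives [e i]
    by duality, and 0 when [dual2] is expanded in the Bernstein basis instead. *)
Lemma wint_Bern_sum_eq0 (n : nat) (a b : R) (e : nat -> R) : -1 < a -> -1 < b ->
  (forall l, (l <= n)%nat -> wint a b (fun x => sum_f_R0 (fun j => e j * Bern n j x) n * Bern n l x) = 0) ->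
  forall i, (i <= n)%nat -> e i = 0.
Proof.
intros Ha Hb H i Hi. set (f := fun x => sum_f_R0 (fun j => e j * Bern n j x) n).
assert (HB : forall k, (k <= n)%nat -> is_poly_le n (Bern n k)) by (intros; apply is_poly_le_Bern; auto).
transitivity (wint a b (fun x => f x * dual2 n a b i x)).
- unfold f. rewrite (wint_mul_sum a b n n n e (Bern n) (dual2 n a b i)); auto; [|apply is_poly_le_Bern_sum].
  rewrite (sum_single _ i n); auto.
  + rewrite wint_comm, wint_dual2_Bern, Nat.eqb_refl by auto. ring.
  + intros k Hk N. rewrite wint_comm, wint_dual2_Bern by auto.
    replace (Nat.eqb i k) with false by (symmetry; apply Nat.eqb_neq; auto). ring.
- rewrite wint_comm. unfold dual2. rewrite (wint_mul_sum a b n n n _ (Bern n) f); auto; [|apply is_poly_le_Bern_sum].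
  apply sum_zero. intros k Hk. rewrite wint_comm. unfold f. rewrite H by auto. ring.
Qed.

(** * Orthogonality and norms of the Jacobi polynomials *)

Lemma poch_1_fact (m : nat) : poch 1 m = INR (fact m).
Proof.
induction m as [|m IH]; [reflexivity|]. rewrite fact_simpl, mult_INR, S_INR. simpl poch. rewrite IH. ring.
Qed.

(** The moments cancel (b+1)_j and leave 2F1(-m, m+a+b+1; a+b+2+k; 1). The factor (k+1-m)_m gives
    both facts used later: it is 0 for k < m and m! for k = m. *)
Lemma wint_jacobi_pow_1X (a b : R) (m k : nat) : -1 < a -> -1 < b ->
  wint a b (fun x => jacobi m b a x * (1 - x) ^ k) =
  betaI a b * (poch (a + 1) k / poch (a + b + 2) k) * (poch (INR k + 1 - INR m) m / poch (a + b + 2 + INR k) m).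
Proof.
intros Ha Hb. unfold jacobi.
assert (Hx : forall j, is_poly_le j (fun x => x ^ j)).
{ intros j. destruct (is_poly_le_monomial j 0) as [p Hp]. exists p. intros x.
  rewrite Nat.add_0_r in Hp. rewrite <- Hp. simpl. ring. }
rewrite (wint_mul_sum a b m m k _ (fun k x => x ^ k) (fun x => (1 - x) ^ k)); auto.
2:{ intros j Hj. apply (is_poly_le_mono j); auto. }
2:{ apply is_poly_le_pow_1X; auto. }
replace (INR k + 1 - INR m) with (a + b + 2 + INR k - (INR m + b + a + 1)) by ring.
assert (Hk := pos_INR k).
rewrite <- chu_vandermonde, sum_scal_l by lra. apply sum_eq. intros j Hj.
rewrite (proj2 (wint_monomial a b j k Ha Hb)), (Nat.add_comm j k), poch_add.
assert (P1 := poch_gt_0 (a + b + 2) k ltac:(lra)). assert (P2 := poch_gt_0 (b + 1) j ltac:(lra)).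
assert (P3 := poch_gt_0 (a + b + 2 + INR k) j ltac:(lra)).
assert (F := INR_fact_neq_0 j). field. repeat split; lra.
Qed.

Lemma wint_jacobi_pow_1X_lt (a b : R) (m k : nat) : -1 < a -> -1 < b -> (k < m)%nat ->
  wint a b (fun x => jacobi m b a x * (1 - x) ^ k) = 0.
Proof.
intros Ha Hb H. rewrite wint_jacobi_pow_1X by auto.
replace (INR k + 1 - INR m) with (- INR (m - S k)) by (rewrite minus_INR, S_INR by lia; ring).
rewrite poch_opp_INR_eq0 by lia. unfold Rdiv at 2. ring.
Qed.

(** The sign from reflection cancels the one in (-m)_m = (-1)^m m!. *)
Lemma jacobi_expand_1X (m : nat) (a b : R) : -1 < a -> -1 < b -> exists u : nat -> R,
  (forall x, jacobi m b a x = sum_f_R0 (fun k => u k * (1 - x) ^ k) m) /\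
  u m = poch (INR m + b + a + 1) m / poch (b + 1) m.
Proof.
intros Ha Hb. unfold jacobi.
destruct (pow_sum_reflect m (fun k => poch (- INR m) k * poch (INR m + b + a + 1) k
    / (INR (fact k) * poch (b + 1) k))) as [u [Hu Hm]].
exists u. split; auto. rewrite Hm.
assert (P := poch_gt_0 (b + 1) m ltac:(lra)). assert (F := INR_fact_neq_0 m).
assert (K := poch_opp_INR_fact m m (le_n m)). rewrite Nat.sub_diag in K.
change (INR (fact 0)) with 1 in K. rewrite Rmult_1_r in K. rewrite K.
assert (E : (-1) ^ m * (-1) ^ m = 1) by apply sign_sqr.
transitivity ((-1) ^ m * (-1) ^ m * (poch (INR m + b + a + 1) m / poch (b + 1) m)).
- field. split; lra.
- rewrite E. ring.
Qed.

Lemma wint_jacobi_orthogonal (a b : R) (m k : nat) : -1 < a -> -1 < b -> m <> k ->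
  wint a b (fun x => jacobi m b a x * jacobi k b a x) = 0.
Proof.
intros Ha Hb.
assert (H : forall m k, (k < m)%nat -> wint a b (fun x => jacobi k b a x * jacobi m b a x) = 0).
{ clear m k. intros m k H. destruct (jacobi_expand_1X k a b Ha Hb) as [u [Hu _]].
  rewrite (wint_ext a b _ (fun x => sum_f_R0 (fun p => u p * (1 - x) ^ p) k * jacobi m b a x))
    by (intros x; rewrite Hu; reflexivity).
  rewrite (wint_mul_sum a b k k m u (fun p x => (1 - x) ^ p) (jacobi m b a)); auto.
  - apply sum_zero. intros p Hp. rewrite wint_comm, wint_jacobi_pow_1X_lt by (auto; lia). ring.
  - intros; apply is_poly_le_pow_1X; auto.
  - apply is_poly_le_jacobi; auto. }
intros N. destruct (Nat.lt_total m k) as [L|[L|L]]; [|lia|].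
- apply H; auto.
- rewrite wint_comm. apply H; auto.
Qed.

(** For m >= 1, 2m+s is the factor that extends (m+s)_m to (m+s)_(m+1), which continues (s+1)_(m-1).
    As a product, the identity also holds for s = 0. *)
Lemma hahn_weight_poch (s : R) (m : nat) : hahn_weight s m * poch (INR m + s) m = poch (s + 1) (m + m).
Proof.
destruct m as [|m]; [simpl; ring|].
unfold hahn_weight. replace (S m + S m)%nat with (m + S (S m))%nat by lia.
rewrite poch_add. replace (s + 1 + INR m) with (INR (S m) + s) by (rewrite S_INR; ring).
change (poch (INR (S m) + s) (S (S m))) with (poch (INR (S m) + s) (S m) * (INR (S m) + s + INR (S m))).
ring.
Qed.

(** Expanding one factor in powers of 1-x, only the top power survives, so the squared norm is
    leading coefficient times one moment. The weights of the first family are thus the inverse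
    squared norms, relative to the total mass. *)
Lemma wint_jacobi_norm (a b : R) (m : nat) : -1 < a -> -1 < b ->
  hahn_weight (a + b + 1) m * poch (b + 1) m / (INR (fact m) * poch (a + 1) m)
  * wint a b (fun x => jacobi m b a x * jacobi m b a x) = betaI a b.
Proof.
intros Ha Hb. destruct (jacobi_expand_1X m a b Ha Hb) as [u [Hu Hm]].
rewrite (wint_ext a b _ (fun x => sum_f_R0 (fun p => u p * (1 - x) ^ p) m * jacobi m b a x))
  by (intros x; rewrite Hu at 1; reflexivity).
rewrite (wint_mul_sum a b m m m u (fun p x => (1 - x) ^ p) (jacobi m b a)); auto.
- rewrite (sum_single _ m m); auto.
  + rewrite wint_comm, wint_jacobi_pow_1X, Hm by auto.
    replace (INR m + 1 - INR m) with 1 by ring. rewrite poch_1_fact.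
    assert (Q := pos_INR m).
    assert (P1 := poch_gt_0 (a + 1) m ltac:(lra)). assert (P2 := poch_gt_0 (b + 1) m ltac:(lra)).
    assert (P3 := poch_gt_0 (a + b + 2) m ltac:(lra)).
    assert (P4 := poch_gt_0 (a + b + 2 + INR m) m ltac:(lra)).
    assert (F := INR_fact_neq_0 m).
    assert (W := hahn_weight_poch (a + b + 1) m). rewrite poch_add in W.
    replace (a + b + 1 + 1) with (a + b + 2) in W by ring.
    replace (INR m + b + a + 1) with (INR m + (a + b + 1)) by ring.
    transitivity (hahn_weight (a + b + 1) m * poch (INR m + (a + b + 1)) m * betaI a b
      / (poch (a + b + 2) m * poch (a + b + 2 + INR m) m)).
    * field. repeat split; lra.
    * rewrite W. field. lra.
  + intros k Hk N. rewrite wint_comm, wint_jacobi_pow_1X_lt by (auto; lia). ring.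
- intros; apply is_poly_le_pow_1X; auto.
- apply is_poly_le_jacobi; auto.
Qed.

(** * The first family, its agreement with the second, and uniqueness *)

Definition dual1 (n : nat) (a b : R) (i : nat) (x : R) : R :=
  sum_f_R0 (fun j => coef1 n a b i j * Bern n j x) n.

Lemma dual1_jacobi (n : nat) (a b : R) (i : nat) (x : R) : -1 < a -> -1 < b ->
  dual1 n a b i x =
  sum_f_R0 (fun m => / betaI a b * (hahn_weight (a + b + 1) m * poch (b + 1) m / (INR (fact m) * poch (a + 1) m))
    * Hahn m (INR i) b a n * jacobi m b a x) n.
Proof.
intros Ha Hb. unfold dual1, coef1. rewrite <- betaI_Beta by auto.
rewrite (sum_eq _ (fun j => sum_f_R0 (fun m => / betaI a b * (hahn_weight (a + b + 1) m * poch (b + 1) m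
    / (INR (fact m) * poch (a + 1) m)) * Hahn m (INR i) b a n * (Hahn m (INR j) b a n * Bern n j x)) n)).
- rewrite sum_exchange. apply sum_eq. intros m Hm. rewrite <- sum_scal_l, sum_Hahn_Bern by auto. reflexivity.
- intros j Hj. rewrite sum_scal_l, sum_scal_r. apply sum_eq; intros; ring.
Qed.

Lemma wint_dual1_jacobi (n : nat) (a b : R) (i k : nat) : -1 < a -> -1 < b -> (k <= n)%nat ->
  wint a b (fun x => dual1 n a b i x * jacobi k b a x) = Hahn k (INR i) b a n.
Proof.
intros Ha Hb Hk. assert (B := betaI_gt_0 a b Ha Hb).
rewrite (wint_ext a b _ (fun x => sum_f_R0 (fun m => / betaI a b * (hahn_weight (a + b + 1) m * poch (b + 1) m
    / (INR (fact m) * poch (a + 1) m)) * Hahn m (INR i) b a n * jacobi m b a x) n * jacobi k b a x))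
  by (intros x; rewrite dual1_jacobi by auto; reflexivity).
rewrite (wint_mul_sum a b n n n _ (fun m => jacobi m b a) (jacobi k b a)); auto;
  try (intros; apply is_poly_le_jacobi; auto).
rewrite (sum_single _ k n); auto.
- transitivity (/ betaI a b * (hahn_weight (a + b + 1) k * poch (b + 1) k / (INR (fact k) * poch (a + 1) k)
    * wint a b (fun x => jacobi k b a x * jacobi k b a x)) * Hahn k (INR i) b a n); [ring|].
  rewrite wint_jacobi_norm by auto. field. lra.
- intros m Hm N. rewrite wint_jacobi_orthogonal by auto. ring.
Qed.

(** Duality picks the i-th coefficient of the Bernstein form of R_k. *)
Lemma wint_dual2_jacobi (n : nat) (a b : R) (i k : nat) : -1 < a -> -1 < b -> (i <= n)%nat -> (k <= n)%nat ->
  wint a b (fun x => dual2 n a b i x * jacobi k b a x) = Hahn k (INR i) b a n.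
Proof.
intros Ha Hb Hi Hk. rewrite wint_comm.
rewrite (wint_ext a b _ (fun x => sum_f_R0 (fun j => Hahn k (INR j) b a n * Bern n j x) n * dual2 n a b i x))
  by (intros x; rewrite sum_Hahn_Bern by auto; reflexivity).
rewrite (wint_mul_sum a b n n n _ (Bern n) (dual2 n a b i)); auto;
  [|intros; apply is_poly_le_Bern; auto|apply is_poly_le_Bern_sum].
rewrite (sum_single _ i n); auto.
- rewrite wint_comm, wint_dual2_Bern, Nat.eqb_refl by auto. ring.
- intros j Hj N. rewrite wint_comm, wint_dual2_Bern by auto.
  replace (Nat.eqb i j) with false by (symmetry; apply Nat.eqb_neq; auto). ring.
Qed.

(** The R_k are triangular in the powers of 1-x with nonzero leading coefficients, so strong
    induction carries orthogonality over to every power. *)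
Lemma wint_orthogonal_of_jacobi (n : nat) (a b : R) (f g : R -> R) : -1 < a -> -1 < b ->
  is_poly_le n f -> (forall k, (k <= n)%nat -> wint a b (fun x => f x * jacobi k b a x) = 0) ->
  is_poly_le n g -> wint a b (fun x => f x * g x) = 0.
Proof.
intros Ha Hb Hf H [c Hc].
assert (M : forall p, (p <= n)%nat -> wint a b (fun x => (1 - x) ^ p * f x) = 0).
{ induction p as [p IH] using (well_founded_induction Nat.lt_wf_0). intros Hp.
  destruct (jacobi_expand_1X p a b Ha Hb) as [u [Hu Hup]].
  assert (U : u p <> 0).
  { rewrite Hup. assert (P := poch_gt_0 (b + 1) p ltac:(lra)).
    apply Rmult_integral_contrapositive_currified; [|apply Rinv_neq_0_compat; lra].
    (* The base p+a+b+1 is positive for p >= 1 only; for p = 0 the symbol is an empty product. *)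
    destruct p as [|p]; [simpl; lra|]. apply Rgt_not_eq, poch_gt_0.
    rewrite S_INR. generalize (pos_INR p); lra. }
  assert (K := H p Hp). rewrite wint_comm in K.
  rewrite (wint_ext a b _ (fun x => sum_f_R0 (fun k => u k * (1 - x) ^ k) p * f x)) in K
    by (intros x; rewrite Hu; reflexivity).
  rewrite (wint_mul_sum a b p p n u (fun k x => (1 - x) ^ k) f) in K; auto;
    [|intros; apply is_poly_le_pow_1X; auto].
  rewrite (sum_single _ p p) in K; auto.
  - apply Rmult_integral in K. destruct K; [contradiction|auto].
  - intros k Hk N. rewrite IH by lia. ring. }
destruct (pow_sum_reflect n c) as [u [Hu _]]. rewrite wint_comm.
rewrite (wint_ext a b _ (fun x => sum_f_R0 (fun k => u k * (1 - x) ^ k) n * f x))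
  by (intros x; rewrite <- Hu, Hc; reflexivity).
rewrite (wint_mul_sum a b n n n u (fun k x => (1 - x) ^ k) f); auto.
- apply sum_zero. intros k Hk. rewrite M by auto. ring.
- intros; apply is_poly_le_pow_1X; auto.
Qed.

Lemma wint_sub_mul (a b : R) (n : nat) (f g h : R -> R) : -1 < a -> -1 < b ->
  is_poly_le n f -> is_poly_le n g -> is_poly_le n h ->
  wint a b (fun x => (f x - g x) * h x) = wint a b (fun x => f x * h x) - wint a b (fun x => g x * h x).
Proof.
intros Ha Hb Hf Hg Hh.
rewrite (wint_ext a b _ (fun x => 1 * (f x * h x) + -1 * (g x * h x))) by (intros; ring).
rewrite (proj2 (wint_lin a b 1 (-1) (fun x => f x * h x) (fun x => g x * h x)
  (is_poly_le_w_integrable a b (n + n) _ Ha Hb (is_poly_le_mul _ _ _ _ Hf Hh))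
  (is_poly_le_w_integrable a b (n + n) _ Ha Hb (is_poly_le_mul _ _ _ _ Hg Hh)))).
ring.
Qed.

Lemma Bern_sum_sub (n : nat) (c d : nat -> R) (x : R) :
  sum_f_R0 (fun j => (c j - d j) * Bern n j x) n =
  sum_f_R0 (fun j => c j * Bern n j x) n - sum_f_R0 (fun j => d j * Bern n j x) n.
Proof. rewrite <- minus_sum. apply sum_eq; intros; ring. Qed.

(** The difference of the two candidates is orthogonal to every R_k, hence to every Bernstein
    polynomial, so its Bernstein coefficients vanish. *)
Lemma coef1_coef2 (n : nat) (a b : R) (i j : nat) : -1 < a -> -1 < b -> (i <= n)%nat -> (j <= n)%nat ->
  coef1 n a b i j = coef2 n a b i j.
Proof.
intros Ha Hb Hi Hj. apply Rminus_diag_uniq. revert j Hj.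
apply (wint_Bern_sum_eq0 n a b (fun j => coef1 n a b i j - coef2 n a b i j)); auto.
intros l Hl.
apply (wint_orthogonal_of_jacobi n a b (fun x => sum_f_R0 (fun j => (coef1 n a b i j - coef2 n a b i j) * Bern n j x) n));
  auto; [apply is_poly_le_Bern_sum| |apply is_poly_le_Bern; auto].
intros k Hk.
rewrite (wint_ext a b _ (fun x => (dual1 n a b i x - dual2 n a b i x) * jacobi k b a x))
  by (intros x; rewrite Bern_sum_sub; reflexivity).
rewrite (wint_sub_mul a b n); auto;
  try apply is_poly_le_Bern_sum; [|apply is_poly_le_jacobi; auto].
rewrite wint_dual1_jacobi, wint_dual2_jacobi by auto. ring.
Qed.

Lemma dual_unique (n : nat) (a b : R) (f g : R -> R) : -1 < a -> -1 < b ->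
  is_poly_le n f -> is_poly_le n g ->
  (forall l, (l <= n)%nat -> wint a b (fun x => f x * Bern n l x) = wint a b (fun x => g x * Bern n l x)) ->
  forall x, f x = g x.
Proof.
intros Ha Hb Hf Hg H x.
destruct (is_poly_le_Bern_expand n f Hf) as [p Hp]. destruct (is_poly_le_Bern_expand n g Hg) as [q Hq].
apply Rminus_diag_uniq. rewrite Hp, Hq, <- Bern_sum_sub. apply sum_zero. intros j Hj.
rewrite (wint_Bern_sum_eq0 n a b (fun j => p j - q j)) by
 (auto; intros l Hl;
  rewrite (wint_ext a b _ (fun x => (f x - g x) * Bern n l x)) by (intros y; rewrite Bern_sum_sub, Hp, Hq; reflexivity);
  rewrite (wint_sub_mul a b n), H by (auto; apply is_poly_le_Bern; auto); ring).
ring.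
Qed.

Theorem theorem2p1 (n : nat) (alpha beta : R)
  (halpha : alpha > -1) (hbeta : beta > -1) (i : nat) (hi : (i <= n)%nat) :
  (forall x : R,
     DualBern n alpha beta i x = sum_f_R0 (fun j => coef1 n alpha beta i j * Bern n j x) n) /\
  (forall j : nat, (j <= n)%nat -> coef1 n alpha beta i j = coef2 n alpha beta i j).
Proof.
apply Rgt_lt in halpha, hbeta.
assert (E : forall j : nat, (j <= n)%nat -> coef1 n alpha beta i j = coef2 n alpha beta i j)
  by (intros; apply coef1_coef2; auto).
split; auto. intros x.
rewrite (sum_eq _ (fun j => coef2 n alpha beta i j * Bern n j x)) by (intros j Hj; rewrite E; auto).
change (DualBern n alpha beta i x = dual2 n alpha beta i x).
set (P := fun f : R -> R => is_poly_le n f /\ forall j, (j <= n)%nat ->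
  inner alpha beta f (Bern n j) = if Nat.eqb i j then 1 else 0).
assert (D : P (DualBern n alpha beta i)).
(* The choice in [DualBern] obeys its specification once a witness exists; the second family
   supplies it, as its duality was proved directly. *)
{ apply (epsilon_spec (inhabits (fun _ : R => 0)) P). exists (dual2 n alpha beta i). split.
  - apply is_poly_le_Bern_sum.
  - intros j Hj. rewrite inner_wint. apply wint_dual2_Bern; auto. }
destruct D as [D1 D2].
apply (dual_unique n alpha beta); auto; [apply is_poly_le_Bern_sum|].
intros l Hl. rewrite wint_dual2_Bern, <- inner_wint by auto. apply D2, Hl.
Qed.
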